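(* Let $X \subseteq \mathbb{R}^n$, $n \ge 2$, be a simple closed set such that for each $z \in \partial X$ there exists a simplex $X_z$ with $z \in X_z \subseteq X$. Then $$\mathscr{C}^\omega_{2,2}(X) = \mathcal{C}^\omega|_X.$$
   Context: Let $X \subseteq \mathbb{R}^n$ be nonempty; $X^\circ$ denotes its interior and $\partial X$ its boundary. Plots: for positive integers $m,d$, an $(m,d)$-plot in $X$ is the germ at $0$ of a polynomial map $p=(p_1,\ldots,p_n):\mathbb{R}^m\to\mathbb{R}^n$ of degree at most $d$ (i.e. $\max_i \deg p_i\le d$) such that $p(U)\subseteq X$ for some neighborhood $U$ of $0$ in $\mathbb{R}^m$. $\mathcal{P}_{m,d}(X)$ is the set of all $(m,d)$-plots in $X$. $\mathscr{C}^\omega_{m,d}(X)$ is the set of all functions $f:X\to\mathbb{R}$ (no continuity or smoothness assumed) such that $f\circ p$ is a real analytic germ at $0\in\mathbb{R}^m$ for all $p\in\mathcal{P}_{m,d}(X)$. For closed $X$, $\mathcal{C}^\omega|_X$ is the set of all functions $f:X\to\mathbb{R}$ for which there exist an open neighborhood $U$ of $X$ in $\mathbb{R}^n$ and a real analytic function $F:U\to\mathbb{R}$ with $F|_X=f$. A simplex in $\mathbb{R}^n$ is the convex hull of any collection of $n+1$ affinely independent points in $\mathbb{R}^n$. $X$ is simple if each $x\in\partial X$ has a basis of neighborhoods $\mathscr{U}$ such that $U\cap X^\circ$ is connected for all $U\in\mathscr{U}$. *)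

(* Defs.v *)
From HB Require Import structures.
From mathcomp Require Import all_boot all_order all_algebra finmap.
From mathcomp Require Import all_classical all_reals all_analysis.
(* the notations of mpoly clash with those of mathcomp-analysis *)
From mathcomp Require mpoly.
Export (canonicals, coercions) mpoly.

Set Implicit Arguments.
Unset Strict Implicit.
Unset Printing Implicit Defensive.

Import Order.TTheory GRing.Theory Num.Theory.
Import numFieldNormedType.Exports.

Local Open Scope classical_set_scope.
Local Open Scope ring_scope.

(* Unconditional summability, that is, convergence of the net of finite partial
   sums; for real families it amounts to absolute convergence. *)
Definition has_sum (R : realType) (I : choiceType) (a : I -> R) (l : R) : Prop :=
  forall e : R, 0 < e -> exists F : {fset I}, forall G : {fset I},
    (F `<=` G)%fset -> `|\sum_(i <- G) a i - l| < e.

(* [mpoly.mmap1 h al] is the monomial \prod_i h i ^+ al i *)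
Definition analytic_at (R : realType) (m : nat) (g : 'rV[R]_m -> R)
    (a : 'rV[R]_m) : Prop :=
  exists c : mpoly.multinom m -> R, \forall x \near a,
    has_sum (fun al : mpoly.multinom m =>
      c al * mpoly.mmap1 (fun i => (x - a) 0 i) al) (g x).

Definition poly_map (R : realType) (m n : nat) : Type := 'I_n -> mpoly.mpoly m R.

Definition poly_map_eval (R : realType) (m n : nat) (p : poly_map R m n)
    (u : 'rV[R]_m) : 'rV[R]_n :=
  \row_i mpoly.meval (fun j => u 0 j) (p i).

(* A polynomial map is determined by its germ at 0, so plots are represented by
   polynomial maps. As msize is 1 + degree, and 0 for the zero polynomial,
   [msize (p i) <= d.+1] says that the degree of [p i] is at most d. *)
Definition plot (R : realType) (m d n : nat) (X : set 'rV[R]_n) :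
    set (poly_map R m n) :=
  [set p | (forall i, (mpoly.msize (p i) <= d.+1)%N) /\
           \forall u \near (0 : 'rV[R]_m), X (poly_map_eval p u)].

(* [f] is a function on the subtype of points of X, hence f \o p only makes sense
   near 0: it is an analytic germ when it agrees near 0 with some [g] that is
   analytic at 0. *)
Definition plot_analytic (R : realType) (m d n : nat) (X : set 'rV[R]_n) :
    set (X -> R) :=
  [set f | forall p : poly_map R m n, plot d X p ->
     exists2 g : 'rV[R]_m -> R, analytic_at g 0 &
       \forall u \near (0 : 'rV[R]_m), forall x : X,
         val x = poly_map_eval p u -> f x = g u].
Arguments plot_analytic {R} m d {n} X.

Definition analytic_restriction (R : realType) (n : nat) (X : set 'rV[R]_n) :
    set (X -> R) :=
  [set f | exists (U : set 'rV[R]_n) (F : 'rV[R]_n -> R),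
     [/\ open U, X `<=` U, (forall x, U x -> analytic_at F x) &
         forall x : X, F (val x) = f x]].
Arguments analytic_restriction {R n} X.

Definition affinely_independent (R : realType) (k n : nat)
    (v : 'I_k -> 'rV[R]_n) : Prop :=
  forall w : 'I_k -> R,
    \sum_i w i = 0 -> \sum_i w i *: v i = 0 -> forall i, w i = 0.

Definition convex_hull (R : realType) (k n : nat) (v : 'I_k -> 'rV[R]_n) :
    set 'rV[R]_n :=
  [set x | exists w : 'I_k -> R,
     [/\ forall i, 0 <= w i, \sum_i w i = 1 & x = \sum_i w i *: v i]].

Definition simplex (R : realType) (n : nat) (S : set 'rV[R]_n) : Prop :=
  exists2 v : 'I_n.+1 -> 'rV[R]_n, affinely_independent v & S = convex_hull v.

Definition boundary (T : topologicalType) (A : set T) : set T :=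
  closure A `\` A°.

(* neighborhoods in the basis B need not be open *)
Definition simple_set (T : topologicalType) (X : set T) : Prop :=
  forall x, boundary X x -> exists B : set (set T),
    [/\ forall U, B U -> nbhs x U,
        forall V, nbhs x V -> exists2 U, B U & U `<=` V &
        forall U, B U -> connected (U `&` X°)].

(* Main.v *)
Require Import Defs.
From HB Require Import structures.
From mathcomp Require Import all_boot all_order all_algebra.
From mathcomp Require Import finmap.
From mathcomp Require Import all_classical all_reals all_analysis.
From mathcomp Require Import ring lra zify.
From mathcomp Require mpoly.
Import Order.TTheory GRing.Theory Num.Theory.
Import numFieldNormedType.Exports.
Local Open Scope classical_set_scope.
Local Open Scope ring_scope.

Set Implicit Arguments.
Unset Strict Implicit.
Unset Printing Implicit Defensive.

(** Restrictions of analytic functions are analytic along all polynomial plots,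
    because power series can be composed.  For the converse, let [f] be analytic
    along quadratic plots.

    Every point [z] of [X] is a vertex of a nondegenerate parallelepiped contained in
    [X]; at a boundary point it comes from the simplex through [z]
    ([simplex_corner]).  In the coordinates of this corner [f] becomes a function [h]
    on a cube with vertex 0.  For [a] and [b] with nonnegative entries, the map
    [(s, t) |-> s^2 a + t^2 b] gives a plot, so [h (s^2 a + t^2 b)] is a power series in
    [s] and [t].  It is even in both variables, hence [h (s a + t b)] is a power series
    in [s] and [t] on the quadrant where they are nonnegative
    ([even_wiener_ray_series]).  Let [G k x] be the coefficient of [t ^+ k] in
    [h (t x)].  By the previous remark [G k] is separately polynomial of degree at
    most [k], and it is homogeneous of degree [k].

    Each sequence [G k x] grows at most exponentially, and Baire's theorem makes this
    uniform on a box ([ray_coefs_uniform_bound]).  Lagrange interpolation on an equally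
    spaced grid in that box shows that [G k] is a polynomial whose coefficients are
    bounded exponentially in [k] ([box_interpolation]).  Therefore the sum of the
    [G k] converges near 0 to an analytic function, which agrees with [h] on short
    initial pieces of the rays and, by continuation along the rays, on a small open
    cube ([corner_expansion]).

    Back in [X], this gives an analytic [F] near [z] that agrees with [f] on open sets
    accumulating at [z].  In the interior of [X] the function [f] has expansions along
    all lines, which is enough for unique continuation along segments, hence over
    connected open sets ([connected_extension]).  As [X] is simple, [F] and [f] agree at
    all interior points near [z].  At a boundary point [y] near [z] they agree too,
    since along a ray into the corner at [y] both have one-sided expansions that
    coincide in the interior ([corner_value]).  Finally the local extensions are glued:
    on balls of half the radius they agree wherever two balls meet ([glue_germs]). *)

Local Notation monom x al := (mpoly.mmap1 (fun i => x 0 i) al).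

(** * Unconditional sums *)

Definition abs_sums_le (R : realType) (I : choiceType) (a : I -> R) (M : R) :=
  forall F : {fset I}, \sum_(i <- F) `|a i| <= M.

Section UnconditionalSums.
Context {R : realType}.
Implicit Types (I J K : choiceType) (M l : R).

Lemma has_sum_unique I (a : I -> R) l l' :
  has_sum a l -> has_sum a l' -> l = l'.
Proof.
move=> h h'; apply/eqP; rewrite -subr_eq0 -normr_le0; apply/ler_addgt0Pr => e e0.
have [F hF] := h _ (divr_gt0 e0 (ltr0n _ 2)).
have [F' hF'] := h' _ (divr_gt0 e0 (ltr0n _ 2)).
have := hF _ (fsubsetUl F F'); have := hF' _ (fsubsetUr F F').
set s := \sum_(_ <- _) _ => A B.
have -> : l - l' = (s - l') - (s - l) by ring.
rewrite add0r (le_trans (ler_normB _ _))// [leRHS]splitr.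
by apply: lerD; apply: ltW.
Qed.

Lemma eq_has_sum I (a b : I -> R) l : a =1 b -> has_sum a l -> has_sum b l.
Proof. by move=> /funext ->. Qed.

Lemma has_sumD I (a b : I -> R) l l' :
  has_sum a l -> has_sum b l' -> has_sum (fun i => a i + b i) (l + l').
Proof.
move=> h h' e e0.
have [F hF] := h _ (divr_gt0 e0 (ltr0n _ 2)).
have [F' hF'] := h' _ (divr_gt0 e0 (ltr0n _ 2)).
exists (F `|` F')%fset => G; rewrite fsubUset => /andP[FG F'G].
rewrite big_split/= opprD addrACA (le_lt_trans (ler_normD _ _))//.
by rewrite [ltRHS]splitr ltrD ?hF ?hF'.
Qed.

Lemma has_sumZ I (a : I -> R) l c :
  has_sum a l -> has_sum (fun i => c * a i) (c * l).
Proof.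
move=> h e e0.
have c0 : 0 < `|c| + 1 by rewrite ltr_wpDl.
have [F hF] := h _ (divr_gt0 e0 c0).
exists F => G /hF; rewrite -mulr_sumr -mulrBr normrM ltr_pdivlMr// => A.
by rewrite (le_lt_trans _ A)// mulrC ler_wpM2l// lerDl.
Qed.

Lemma has_sum_finite I (a : I -> R) (s : seq I) :
  uniq s -> (forall i, i \notin s -> a i = 0) ->
  has_sum a (\sum_(i <- s) a i).
Proof.
move=> us a0 e e0; exists [fset i in s]%fset => G sG.
have -> : \sum_(i <- s) a i = \sum_(i <- [fset i in s]%fset) a i.
  apply: perm_big; apply: uniq_perm => //.
  by move=> i; rewrite inE.
rewrite (big_fset_incl _ sG) ?subrr ?normr0// => i _.
by rewrite inE => /a0.
Qed.

Lemma abs_sums_le_finite I (a : I -> R) (s : seq I) :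
  uniq s -> (forall i, i \notin s -> a i = 0) ->
  abs_sums_le a (\sum_(i <- s) `|a i|).
Proof.
move=> us a0 F; rewrite (bigID (mem s)) /= [X in _ + X]big1 ?addr0; last first.
  by move=> i /a0 ->; rewrite normr0.
rewrite big_fset_condE [leRHS](bigID (mem F)) /= -[leRHS]/(_ + _).
set A := bigop _ _ _; set B := bigop _ _ _; set C := bigop _ _ _.
suff -> : A = B by rewrite lerDl sumr_ge0.
rewrite /A /B -[RHS]big_filter; apply: perm_big; apply: uniq_perm => //.
  exact: filter_uniq.
by move=> i; rewrite mem_filter !inE /= andbC.
Qed.

Lemma has_sum0 I (a : I -> R) : (forall i, a i = 0) -> has_sum a 0.
Proof.
by move=> a0; have := @has_sum_finite _ a [::] isT (fun i _ => a0 i); rewrite big_nil.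
Qed.

Lemma has_sum_big I K (s : seq K) (a : K -> I -> R) (b : K -> R) :
  (forall k, k \in s -> has_sum (a k) (b k)) ->
  has_sum (fun i => \sum_(k <- s) a k i) (\sum_(k <- s) b k).
Proof.
elim: s => [|k s IH] h.
  by rewrite big_nil; apply: has_sum0 => i; rewrite big_nil.
rewrite big_cons; apply: (eq_has_sum (a := fun i => a k i + \sum_(k <- s) a k i)).
  by move=> i; rewrite big_cons.
apply: has_sumD; first by apply: h; rewrite mem_head.
by apply: IH => k' k's; apply: h; rewrite inE k's orbT.
Qed.

Lemma abs_sums_le_ge0 I (a : I -> R) M : abs_sums_le a M -> 0 <= M.
Proof. by move=> /(_ fset0); rewrite big_seq_fset0. Qed.

Lemma abs_sums_le_term I (a : I -> R) M i : abs_sums_le a M -> `|a i| <= M.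
Proof. by move=> /(_ [fset i]%fset); rewrite big_seq_fset1. Qed.

Lemma abs_sums_le_mono I (a b : I -> R) M :
  (forall i, `|b i| <= `|a i|) -> abs_sums_le a M -> abs_sums_le b M.
Proof. by move=> ba h F; apply: le_trans (h F); apply: ler_sum. Qed.

Lemma abs_sums_le_trans I (a : I -> R) M M' :
  M <= M' -> abs_sums_le a M -> abs_sums_le a M'.
Proof. by move=> MM' h F; apply: le_trans (h F) MM'. Qed.

Lemma abs_sums_leD I (a b : I -> R) M M' :
  abs_sums_le a M -> abs_sums_le b M' ->
  abs_sums_le (fun i => a i + b i) (M + M').
Proof.
move=> h h' F; apply: le_trans (lerD (h F) (h' F)).
by rewrite -big_split/=; apply: ler_sum => i _; exact: ler_normD.
Qed.

Lemma abs_sums_leZ I (a : I -> R) M c :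
  abs_sums_le a M -> abs_sums_le (fun i => c * a i) (`|c| * M).
Proof.
move=> h F; under eq_bigr do rewrite normrM.
by rewrite -mulr_sumr ler_wpM2l.
Qed.

Lemma has_sum_abs_le I (a : I -> R) l M :
  has_sum a l -> abs_sums_le a M -> `|l| <= M.
Proof.
move=> h aM; apply/ler_addgt0Pr => e /h[F /(_ F (fsubset_refl _)) hF].
rewrite -[l](subKr (\sum_(i <- F) a i)) (le_trans (ler_normB _ _))//.
apply: lerD; last exact: ltW.
exact: le_trans (ler_norm_sum _ _ _) (aM F).
Qed.

Lemma nonneg_has_sum I (a : I -> R) M :
  (forall i, 0 <= a i) -> abs_sums_le a M -> exists l, has_sum a l.
Proof.
move=> a0 h; pose S := [set \sum_(i <- F) a i | F in [set: {fset I}]].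
have hS : has_sup S.
  split; first by exists (\sum_(i <- fset0) a i), fset0.
  exists M => _ [F _ <-]; apply: le_trans (h F).
  by apply: ler_sum => i _; rewrite ger0_norm.
exists (sup S) => e e0; have [_ [F _ <-] hF] := sup_adherent e0 hS.
exists F => G FG.
have FGs : \sum_(i <- F) a i <= \sum_(i <- G) a i.
  rewrite [leRHS](big_fsetID _ (mem F)) /=.
  have -> : [fset x in G | x \in F]%fset = F.
    apply/fsetP => x; rewrite !inE/= andbC; case: (boolP (x \in F)) => //= xF.
    by rewrite (fsubsetP FG).
  by rewrite lerDl sumr_ge0.
have GS : \sum_(i <- G) a i <= sup S.
  by apply: sup_upper_bound => //; exists G.
rewrite ler0_norm ?subr_le0// opprB; lra.
Qed.

Lemma abs_sums_le_has_sum I (a : I -> R) M :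
  abs_sums_le a M -> exists l, has_sum a l.
Proof.
move=> h.
have hn : abs_sums_le (fun i => `|a i|) M.
  by move=> F; under eq_bigr do rewrite normr_id; exact: h.
have [p hp] : exists l, has_sum (fun i => a i + `|a i|) l.
  apply: (@nonneg_has_sum _ _ (M + M)); last exact: abs_sums_leD.
  by move=> i; rewrite -lerBlDl sub0r -normrN ler_norm.
have [q hq] := nonneg_has_sum (fun i => normr_ge0 (a i)) hn.
exists (p + - 1 * q).
apply: eq_has_sum (has_sumD hp (has_sumZ (-1) hq)) => i.
by rewrite mulN1r addrK.
Qed.

(** Outside a finite set on which the partial sums have nearly converged, the
    terms of one sign have bounded sums; this is where real unconditional
    convergence becomes absolute convergence. *)
Lemma has_sum_abs_sums_le I (a : I -> R) l :
  has_sum a l -> exists M, abs_sums_le a M.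
Proof.
move=> /(_ _ (ltr01)) [F hF].
exists (\sum_(i <- F) `|a i| + 4) => H.
have part (P : pred I) :
    `|\sum_(i <- [fset x in (H `\` F)%fset | P x]%fset) a i| <= 2.
  set G := [fset x in _ | P x]%fset.
  have -> : \sum_(i <- G) a i = (\sum_(i <- (F `|` G)%fset) a i - l)
      - (\sum_(i <- F) a i - l).
    rewrite (big_fsetID _ (mem F) (F `|` G)%fset) /=.
    have -> : [fset x in (F `|` G)%fset | x \in F]%fset = F.
      by apply/fsetP => x; rewrite !inE /=; case: (x \in F) => //=; rewrite andbF.
    have -> : [fset x in (F `|` G)%fset | x \notin F]%fset = G.
      apply/fsetP => x; rewrite !inE /=.
      by case: (x \in F) => //=; rewrite ?andbT ?andbF.
    by ring.
  rewrite (le_trans (ler_normB _ _))// -[leRHS]/(1 + 1).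
  by apply: lerD; apply: ltW; apply: hF; rewrite ?fsubsetUl ?fsubset_refl.
rewrite (big_fsetID _ (mem F)) /= lerD//.
  rewrite [leRHS](big_fsetID _ (mem H))/=.
  rewrite (_ : [fset x in F | x \in H]%fset = [fset x in H | x \in F]%fset).
    by rewrite lerDl sumr_ge0.
  by apply/fsetP => x; rewrite !inE/= andbC.
have -> : [fset x in H | x \notin F]%fset = (H `\` F)%fset.
  by apply/fsetP => x; rewrite !inE/= andbC.
rewrite (big_fsetID _ (fun i => 0 <= a i)) /= -[leRHS]/(2 + 2)%:R natrD.
apply: lerD; apply: le_trans (part _); rewrite le_eqVlt.
  apply/orP; left; apply/eqP; rewrite ger0_norm.
    by apply: eq_fbigr => i; rewrite !inE/= => /andP[_ /ger0_norm].
  by rewrite big_seq sumr_ge0// => i; rewrite !inE/= => /andP[_].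
apply/orP; left; apply/eqP; rewrite ler0_norm.
  rewrite -sumrN; apply: eq_fbigr => i; rewrite !inE/= -ltNge => /andP[_].
  by move/ltW/ler0_norm.
rewrite big_seq sumr_le0// => i; rewrite !inE/= -ltNge => /andP[_].
exact: ltW.
Qed.

(** Summation by blocks: the blocks are the fibers of an arbitrary map, which
    covers both iterated sums and reindexed products. *)
Lemma has_sum_fibers I J (p : J -> I) (a : J -> R) (b : I -> R) M :
  abs_sums_le a M ->
  (forall i, has_sum (fun j => if p j == i then a j else 0) (b i)) ->
  abs_sums_le b M /\ (forall l, has_sum a l -> has_sum b l).
Proof.
move=> aM hb.
have pick (G : {fset I}) (w : I -> R) j :
    \sum_(i <- G) w i * (if p j == i then a j else 0) =
    if p j \in G then w (p j) * a j else 0.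
  case: ifPn => pG.
    rewrite (big_fsetD1 (p j))//= eqxx big1_fset ?addr0// => i.
    by rewrite !inE eq_sym => /andP[/negbTE -> _] _; rewrite mulr0.
  rewrite big1_fset// => i iG _; case: eqP => [E|_]; last by rewrite mulr0.
  by rewrite E iG in pG.
split=> [G|l hl e e0].
  have := has_sum_big (s := G) (fun i _ => has_sumZ (Num.sg (b i)) (hb i)).
  have -> : \sum_(i <- G) Num.sg (b i) * b i = \sum_(i <- G) `|b i|.
    by apply: eq_bigr => i _; rewrite -normrEsg.
  have bG : abs_sums_le
      (fun j => \sum_(i <- G) Num.sg (b i) * (if p j == i then a j else 0)) M.
    apply: abs_sums_le_mono aM => j; rewrite pick; case: ifP => _; last first.
      by rewrite normr0.
    by rewrite normrM ler_piMl// normr_sg lern1 leq_b1.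
  move=> /has_sum_abs_le/(_ bG); rewrite ger0_norm//.
  by rewrite sumr_ge0.
have [F hF] := hl _ (divr_gt0 e0 (ltr0n _ 2)).
exists [fset p j | j in F]%fset => G FG.
have := has_sum_big (s := G) (fun i _ => hb i).
move=> /(_ _ (divr_gt0 e0 (ltr0n _ 2))) [H] /(_ (F `|` H)%fset (fsubsetUr _ _)).
have -> : \sum_(i <- (F `|` H)%fset) \sum_(k <- G) (if p i == k then a i else 0)
   = \sum_(i <- [fset x in (F `|` H)%fset | p x \in G]%fset) a i.
  under eq_bigr => j _.
    have := pick G (fun=> 1) j; under eq_bigr do rewrite mul1r.
    rewrite mul1r => ->.
    over.
  by rewrite -big_mkcond big_fset_condE.
have /hF : (F `<=` [fset x in F `|` H | p x \in G])%fset.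
  apply/fsubsetP => x xF; rewrite !inE xF /=.
  by apply: (fsubsetP FG); apply/imfsetP; exists x.
set s := \sum_(_ <- _) _; set t := \sum_(_ <- _) _ => A B.
have -> : t - l = (s - l) - (s - t) by ring.
by rewrite (le_lt_trans (ler_normB _ _))// [ltRHS]splitr ltrD.
Qed.

(** The terms outside one row are replaced by zeros, to turn iterated summation
    into summation over the fibers of the first projection. *)
Lemma has_sum_row I J (a : I * J -> R) (i : I) l :
  has_sum (fun j => a (i, j)) l ->
  has_sum (fun x => if x.1 == i then a x else 0) l.
Proof.
move=> h e /h[F hF]; exists [fset (i, j) | j in F]%fset => G FG.
have /hF : (F `<=` [fset x.2 | x in [fset x in G | x.1 == i]])%fset.
  apply/fsubsetP => j jF; apply/imfsetP; exists (i, j) => //=.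
  by rewrite !inE/= eqxx andbT; apply: (fsubsetP FG); apply/imfsetP; exists j.
rewrite big_imfset /=; last first.
  by move=> [x y] [x' y']; rewrite !inE/= => /andP[_ /eqP ->] /andP[_ /eqP ->] ->.
rewrite -big_mkcond; congr (`|_ - _| < _); rewrite [RHS]big_fset_condE.
by apply: eq_fbigr => -[x y]; rewrite !inE/= => /andP[_ /eqP ->].
Qed.

Lemma has_sum_iterated I J (a : I * J -> R) (b : I -> R) M :
  abs_sums_le a M -> (forall i, has_sum (fun j => a (i, j)) (b i)) ->
  abs_sums_le b M /\ (forall l, has_sum a l -> has_sum b l).
Proof.
by move=> aM h; apply: (has_sum_fibers (p := fst) aM) => i; exact: has_sum_row.
Qed.

Lemma abs_sums_le_rows I J (a : I * J -> R) (N : I -> R) M :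
  (forall i, abs_sums_le (fun j => a (i, j)) (N i)) -> abs_sums_le N M ->
  abs_sums_le a M.
Proof.
move=> aN NM F; rewrite (partition_big_imfset _ fst) /=.
apply: le_trans (NM [fset x.1 | x in F]%fset); apply: ler_sum => i _.
apply: le_trans (ler_norm _); rewrite big_fset_condE.
apply: le_trans (aN i [fset x.2 | x in [fset x in F | x.1 == i]]%fset).
rewrite [leRHS]big_imfset /=; last first.
  by move=> [x y] [x' y']; rewrite !inE/= => /andP[_ /eqP ->] /andP[_ /eqP ->] ->.
rewrite le_eqVlt; apply/orP; left; apply/eqP.
by apply: eq_fbigr => -[x y]; rewrite !inE/= => /andP[_ /eqP ->].
Qed.

Lemma abs_sums_leM I J (a : I -> R) (b : J -> R) M M' :
  abs_sums_le a M -> abs_sums_le b M' ->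
  abs_sums_le (fun x : I * J => a x.1 * b x.2) (M * M').
Proof.
move=> aM bM; apply: (@abs_sums_le_rows _ _ _ (fun i => `|a i| * M')) => [i|].
  exact: (abs_sums_leZ (a i) bM).
move=> F; have := ler_wpM2r (abs_sums_le_ge0 bM) (aM F).
rewrite mulr_suml; apply: le_trans; apply: ler_sum => i _.
by rewrite normrM normr_id (ger0_norm (abs_sums_le_ge0 bM)).
Qed.

Lemma has_sumM I J (a : I -> R) (b : J -> R) l l' M M' :
  abs_sums_le a M -> abs_sums_le b M' -> has_sum a l -> has_sum b l' ->
  has_sum (fun x : I * J => a x.1 * b x.2) (l * l').
Proof.
move=> aM bM al bl; have h := abs_sums_leM aM bM.
have [k hk] := abs_sums_le_has_sum h.
have [_ /(_ _ hk)] := has_sum_iterated h (fun i => has_sumZ (a i) bl).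
move=> /has_sum_unique kE; suff -> : l * l' = k by [].
apply/esym/kE; rewrite mulrC; apply: eq_has_sum (has_sumZ l' al) => i.
exact: mulrC.
Qed.

Lemma abs_sums_le_geometric (N : R) :
  0 <= N -> abs_sums_le (fun k : nat => N * 2^-1 ^+ k) (2 * N).
Proof.
move=> N0 F.
have h2 : 0 <= 2^-1 :> R by rewrite invr_ge0.
have [n kn] : exists n, forall k, k \in F -> (k < n)%N.
  exists (\max_(k <- F) k).+1 => k kF.
  by rewrite ltnS (@leq_bigmax_seq _ (enum_fset F) xpredT id k).
have Fn : (F `<=` [fset k in iota 0 n])%fset.
  by apply/fsubsetP => k kF; rewrite !inE/= mem_iota kn.
have pos k : 0 <= N * 2^-1 ^+ k by rewrite mulr_ge0// exprn_ge0.
have -> : \sum_(i <- F) `|N * 2^-1 ^+ i| = \sum_(i <- F) N * 2^-1 ^+ i.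
  by apply: eq_bigr => i _; rewrite ger0_norm.
have : \sum_(i <- F) N * 2^-1 ^+ i <= \sum_(i <- [fset k in iota 0 n]%fset) N * 2^-1 ^+ i.
  rewrite [leRHS](big_fsetID _ (mem F)) /=.
  rewrite (_ : [fset x in _ | x \in F]%fset = F) ?lerDl ?sumr_ge0//.
  apply/fsetP => x; rewrite !inE/= andbC; case: (boolP (x \in F)) => //= xF.
  by have := fsubsetP Fn x xF; rewrite !inE.
move=> /le_trans; apply.
have -> : \sum_(i <- [fset k in iota 0 n]%fset) N * 2^-1 ^+ i = \sum_(0 <= i < n) N * 2^-1 ^+ i.
  apply: perm_big; apply: uniq_perm => //; rewrite ?iota_uniq//.
  by move=> i; rewrite inE /index_iota subn0.
suff -> : \sum_(0 <= i < n) N * 2^-1 ^+ i = 2 * N - 2 * N * 2^-1 ^+ n.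
  by rewrite lerBlDr lerDl !mulr_ge0// exprn_ge0.
elim: n {kn Fn} => [|n IH]; first by rewrite big_nil expr0; ring.
by rewrite big_nat_recr//= IH exprS; field.
Qed.

End UnconditionalSums.

(** * Convergent power series on polydiscs *)

Definition in_box (R : realType) (n : nat) (rho : R) (x : 'rV[R]_n) :=
  forall i, `|x 0 i| <= rho.

(** Functions in the weighted Wiener algebra of the polydisc of radius [rho],
    of norm at most [M].  The norm is submultiplicative, so it controls sums,
    products and compositions of power series without any explicit handling of
    their coefficients. *)
Definition wiener (R : realType) (n : nat) (rho M : R) (g : 'rV[R]_n -> R) :=
  exists c : mpoly.multinom n -> R,
    abs_sums_le (fun al => c al * rho ^+ mpoly.mdeg al) M /\
    forall x, in_box rho x -> has_sum (fun al => c al * monom x al) (g x).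

Section Wiener.
Context {R : realType}.
Implicit Types (n m : nat) (rho M : R).



Lemma in_box_le n rho rho' (x : 'rV[R]_n) :
  rho <= rho' -> in_box rho x -> in_box rho' x.
Proof. by move=> h hx i; exact: le_trans (hx i) h. Qed.

Lemma in_boxZ n rho t (x : 'rV[R]_n) :
  `|t| <= 1 -> in_box rho x -> in_box rho (t *: x).
Proof.
move=> t1 hx i; rewrite mxE normrM; apply: le_trans (hx i).
by rewrite ler_piMl.
Qed.

Lemma near_boxP n (a : 'rV[R]_n) (P : set 'rV[R]_n) :
  (\forall x \near a, P x) <->
  exists2 e, 0 < e & forall x, in_box e (x - a) -> P x.
Proof.
split.
  move=> /nbhs_ballP[e /= e0 h]; exists (e / 2); first by rewrite divr_gt0.
  move=> x hx; apply: h; split=> // i j; rewrite /ball/= ord1 distrC.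
  have := hx j; rewrite !mxE => /le_lt_trans; apply.
  by rewrite ltr_pdivrMr// ltr_pMr// ltr1n.
move=> [e e0 h]; apply/nbhs_ballP; exists e => //= x hx; apply: h => i.
by have := hx.2 0 i; rewrite /ball/= distrC !mxE => /ltW.
Qed.

Lemma monom_scale n t (x : 'rV[R]_n) al :
  monom (t *: x) al = t ^+ mpoly.mdeg al * monom x al.
Proof.
rewrite /mpoly.mmap1 mpoly.mdegE -prodrXr -big_split /=.
by apply: eq_bigr => i _; rewrite mxE exprMn.
Qed.

Lemma monomD n (x : 'rV[R]_n) al be :
  monom x (mpoly.mnm_add al be) = monom x al * monom x be.
Proof. by apply: mpoly.commr_mmap1_M => i y; rewrite /GRing.comm mulrC. Qed.

Lemma monom_le n rho (x : 'rV[R]_n) al :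
  in_box rho x -> `|monom x al| <= rho ^+ mpoly.mdeg al.
Proof.
move=> hx; rewrite /mpoly.mmap1 mpoly.mdegE -prodrXr normr_prod.
apply: ler_prod => i _; rewrite normr_ge0/= normrX lerXn2r// nnegrE//.
exact: le_trans (hx i).
Qed.

Lemma wiener_terms_le n rho M (c : mpoly.multinom n -> R) (x : 'rV[R]_n) :
  abs_sums_le (fun al => c al * rho ^+ mpoly.mdeg al) M -> in_box rho x ->
  abs_sums_le (fun al => c al * monom x al) M.
Proof.
move=> h hx; apply: abs_sums_le_mono h => al; rewrite !normrM ler_wpM2l//.
exact: le_trans (monom_le al hx) (ler_norm _).
Qed.

Lemma wiener_le n rho M (g : 'rV[R]_n -> R) x :
  wiener rho M g -> in_box rho x -> `|g x| <= M.
Proof.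
by move=> [c [h hg]] hx; apply: has_sum_abs_le (hg _ hx) (wiener_terms_le h hx).
Qed.

Lemma wiener_ge0 n rho M (g : 'rV[R]_n -> R) : wiener rho M g -> 0 <= M.
Proof. by move=> [c [/abs_sums_le_ge0]]. Qed.

Lemma eq_wiener n rho M (g g' : 'rV[R]_n -> R) :
  (forall x, in_box rho x -> g x = g' x) -> wiener rho M g -> wiener rho M g'.
Proof. by move=> E [c [h hg]]; exists c; split=> // x hx; rewrite -E//; apply: hg. Qed.

Lemma wiener_norm_le n rho M M' (g : 'rV[R]_n -> R) :
  M <= M' -> wiener rho M g -> wiener rho M' g.
Proof. by move=> h [c [hc hg]]; exists c; split=> //; exact: abs_sums_le_trans hc. Qed.

Lemma wiener_radius_le n rho rho' M (g : 'rV[R]_n -> R) :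
  0 <= rho' <= rho -> wiener rho M g -> wiener rho' M g.
Proof.
move=> /andP[r0 rr] [c [h hg]]; exists c; split=> [|x hx]; last first.
  by apply: hg; exact: in_box_le hx.
apply: abs_sums_le_mono h => al; rewrite !normrM ler_wpM2l// !normrX lerXn2r//.
by rewrite ger0_norm// ger0_norm// (le_trans r0).
Qed.

(** Equal exponents may repeat here, even infinitely often: collecting them is a
    summation by blocks.  Products and infinite sums of power series are of this
    form. *)
Lemma wiener_collect n (J : choiceType) rho M (e : J -> mpoly.multinom n)
    (a : J -> R) (g : 'rV[R]_n -> R) :
  0 < rho -> abs_sums_le (fun j => a j * rho ^+ mpoly.mdeg (e j)) M ->
  (forall x, in_box rho x -> has_sum (fun j => a j * monom x (e j)) (g x)) ->
  wiener rho M g.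
Proof.
move=> r0 aM hg.
have rn0 al : rho ^+ mpoly.mdeg al != 0 :> R by rewrite expf_neq0// gt_eqF.
have fib al : exists l, has_sum
    (fun j => if e j == al then a j * rho ^+ mpoly.mdeg (e j) else 0) l.
  apply: (@abs_sums_le_has_sum _ _ _ M); apply: abs_sums_le_mono aM => j.
  by case: ifP => _ //; rewrite normr0.
have [l hl] := choice fib.
exists (fun al => l al / rho ^+ mpoly.mdeg al); split=> [|x hx].
  have [lM _] := has_sum_fibers aM hl.
  by apply: abs_sums_le_mono lM => al; rewrite divfK.
have axM : abs_sums_le (fun j => a j * monom x (e j)) M.
  apply: abs_sums_le_mono aM => j; rewrite !normrM ler_wpM2l//.
  exact: le_trans (monom_le _ hx) (ler_norm _).
have [|_] := has_sum_fibers (p := e)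
  (b := fun al => l al / rho ^+ mpoly.mdeg al * monom x al) axM.
  move=> al.
  have := has_sumZ ((rho ^+ mpoly.mdeg al)^-1 * monom x al) (hl al).
  rewrite -mulrA [RHS in has_sum _ RHS]mulrC mulrA.
  apply: eq_has_sum => j; case: eqP => [->|_]; last by rewrite mulr0.
  by field.
by apply; exact: hg.
Qed.

Lemma wiener_monom n rho al :
  0 < rho -> wiener rho (rho ^+ mpoly.mdeg al) (fun x : 'rV[R]_n => monom x al).
Proof.
move=> r0; exists (fun be => (be == al)%:R); split=> [|x hx].
  have := @abs_sums_le_finite _ _ (fun be => (be == al)%:R * rho ^+ mpoly.mdeg be)
    [:: al] isT.
  rewrite big_seq1 eqxx mul1r ger0_norm ?exprn_ge0 ?ltW//; apply=> be.
  by rewrite inE => /negbTE ->; rewrite mul0r.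
have := @has_sum_finite _ _ (fun be => (be == al)%:R * monom x be) [:: al] isT.
rewrite big_seq1 eqxx mul1r; apply=> be.
by rewrite inE => /negbTE ->; rewrite mul0r.
Qed.

Lemma wienerZ n rho M (g : 'rV[R]_n -> R) c :
  wiener rho M g -> wiener rho (`|c| * M) (fun x => c * g x).
Proof.
move=> [d [h hg]]; exists (fun al => c * d al); split=> [|x hx].
  by apply: abs_sums_le_mono (abs_sums_leZ c h) => al; rewrite mulrA.
by apply: eq_has_sum (has_sumZ c (hg _ hx)) => al; rewrite mulrA.
Qed.

Lemma wienerD n rho M M' (g g' : 'rV[R]_n -> R) :
  wiener rho M g -> wiener rho M' g' -> wiener rho (M + M') (fun x => g x + g' x).
Proof.
move=> [c [h hg]] [c' [h' hg']]; exists (fun al => c al + c' al); split=> [|x hx].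
  by apply: abs_sums_le_mono (abs_sums_leD h h') => al; rewrite mulrDl.
by apply: eq_has_sum (has_sumD (hg _ hx) (hg' _ hx)) => al; rewrite mulrDl.
Qed.

Lemma wiener_cst n rho a : 0 < rho -> wiener rho `|a| (fun _ : 'rV[R]_n => a).
Proof.
move=> r0; have := wienerZ a (wiener_monom (mpoly.mnm0 : mpoly.multinom n) r0).
rewrite mpoly.mdeg0 expr0 mulr1; apply: eq_wiener => x _.
by rewrite mpoly.mmap11 mulr1.
Qed.

Lemma wiener_coord n rho i : 0 < rho -> wiener rho rho (fun x : 'rV[R]_n => x 0 i).
Proof.
move=> r0; have := wiener_monom (mpoly.mnm1 i) r0.
rewrite mpoly.mdeg1 expr1; apply: eq_wiener => x _.
exact: mpoly.mmap1U.
Qed.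

Lemma wienerM n rho M M' (g g' : 'rV[R]_n -> R) : 0 < rho ->
  wiener rho M g -> wiener rho M' g' -> wiener rho (M * M') (fun x => g x * g' x).
Proof.
move=> r0 [c [h hg]] [c' [h' hg']].
apply: (wiener_collect (e := fun x => mpoly.mnm_add x.1 x.2)
  (a := fun x => c x.1 * c' x.2)) => // [|x hx].
  apply: abs_sums_le_mono (abs_sums_leM h h') => -[al be] /=.
  by rewrite mpoly.mdegD exprD mulrACA.
have := has_sumM (wiener_terms_le h hx) (wiener_terms_le h' hx) (hg _ hx) (hg' _ hx).
by apply: eq_has_sum => -[al be]; rewrite /= monomD mulrACA.
Qed.

Lemma wiener_sum n (I : Type) (s : seq I) rho (M : I -> R) (g : I -> 'rV[R]_n -> R) :
  0 < rho -> (forall i, wiener rho (M i) (g i)) ->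
  wiener rho (\sum_(i <- s) M i) (fun x => \sum_(i <- s) g i x).
Proof.
move=> r0 h; elim: s => [|i s IH].
  have := wiener_cst n 0 r0; rewrite big_nil normr0.
  by apply: eq_wiener => x _; rewrite big_nil.
rewrite big_cons; apply: eq_wiener (wienerD (h i) IH) => x _.
by rewrite big_cons.
Qed.

Lemma wiener_prod n (I : Type) (s : seq I) (P : pred I) rho (M : I -> R)
    (g : I -> 'rV[R]_n -> R) :
  0 < rho -> (forall i, wiener rho (M i) (g i)) ->
  wiener rho (\prod_(i <- s | P i) M i) (fun x => \prod_(i <- s | P i) g i x).
Proof.
move=> r0 h; elim: s => [|i s IH].
  have := wiener_cst n 1 r0; rewrite big_nil normr1.
  by apply: eq_wiener => x _; rewrite big_nil.
rewrite big_cons; case: ifP => Pi.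
  by apply: eq_wiener (wienerM r0 (h i) IH) => x _; rewrite big_cons Pi.
by apply: eq_wiener IH => x _; rewrite big_cons Pi.
Qed.

Lemma wienerX n rho M (g : 'rV[R]_n -> R) k :
  0 < rho -> wiener rho M g -> wiener rho (M ^+ k) (fun x => g x ^+ k).
Proof.
move=> r0 h; have := wiener_prod (index_enum 'I_k) xpredT r0 (fun _ => h).
by rewrite prodr_const card_ord; apply: eq_wiener => x _; rewrite prodr_const card_ord.
Qed.

(** The coefficients of all the [g k] form one summable family, to be collected
    by exponent; summing it in the other order gives the value. *)
Lemma wiener_series n (K : choiceType) rho M (N : K -> R)
    (g : K -> 'rV[R]_n -> R) (G : 'rV[R]_n -> R) :
  0 < rho -> (forall k, wiener rho (N k) (g k)) -> abs_sums_le N M ->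
  (forall x, in_box rho x -> has_sum (fun k => g k x) (G x)) ->
  wiener rho M G.
Proof.
move=> r0 hg NM hG; have [c hc] := choice hg.
have cM : abs_sums_le
    (fun x : K * _ => c x.1 x.2 * rho ^+ mpoly.mdeg x.2) M.
  by apply: (abs_sums_le_rows _ NM) => k; exact: (hc k).1.
apply: (wiener_collect r0 cM) => x hx.
have xM : abs_sums_le (fun y : K * _ => c y.1 y.2 * monom x y.2) M.
  by apply: (abs_sums_le_rows _ NM) => k; exact: wiener_terms_le (hc k).1 hx.
have [l hl] := abs_sums_le_has_sum xM.
have [_ /(_ _ hl) gl] := has_sum_iterated xM (fun k => (hc k).2 _ hx).
by rewrite (has_sum_unique (hG _ hx) gl).
Qed.

(** Each monomial of [g] becomes a product of powers of the components of [q],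
    whose norms are at most the radius [r]: the composed series is dominated, term
    by term, by the series of [g]. *)
Lemma wiener_comp n m rho r M (N : 'I_n -> R) (g : 'rV[R]_n -> R)
    (q : 'rV[R]_m -> 'rV[R]_n) :
  0 < rho -> wiener r M g -> (forall i, wiener rho (N i) (fun u => q u 0 i)) ->
  (forall i, N i <= r) -> wiener rho M (g \o q).
Proof.
move=> r0 [c [h hg]] hq Nr.
have N0 i : 0 <= N i by apply: wiener_ge0 (hq i).
apply: (wiener_series (g := fun al u => c al * monom (q u) al)
  (N := fun al => `|c al| * \prod_i N i ^+ al i)) => // [al||u hu].
- by apply: wienerZ; apply: wiener_prod => // i; apply: wienerX.
- apply: abs_sums_le_mono h => al; rewrite !normrM normr_id ler_wpM2l// mpoly.mdegE.
  rewrite -prodrXr !normr_prod; apply: ler_prod => i _.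
  by rewrite normr_ge0/= !ger0_norm ?exprn_ge0 ?(le_trans (N0 i))// lerXn2r ?nnegrE ?(le_trans (N0 i)).
- by apply: hg => i; exact: le_trans (wiener_le (hq i) hu) (Nr i).
Qed.

(** Grouping the terms by total degree.  The part of degree [k] gains a factor
    [(r / rho) ^+ k] when the polydisc shrinks. *)
Lemma wiener_homogeneous n rho M (g : 'rV[R]_n -> R) :
  0 < rho -> wiener rho M g ->
  exists H : nat -> 'rV[R]_n -> R,
    [/\ forall k r, 0 <= r <= rho -> wiener r (M * (r / rho) ^+ k) (H k),
        forall x, in_box rho x -> abs_sums_le (H ^~ x) M,
        forall x, in_box rho x -> has_sum (H ^~ x) (g x) &
        forall k t x, in_box rho x -> `|t| <= 1 -> H k (t *: x) = t ^+ k * H k x].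
Proof.
move=> r0 [c [h hg]].
pose part (k : nat) (x : 'rV[R]_n) (al : mpoly.multinom n) := if mpoly.mdeg al == k then c al * monom x al else 0 : R.
have ex (k : nat) (x : 'rV[R]_n) : exists l, in_box rho x -> has_sum (part k x) l.
  have [hx|hx] := pselect (in_box rho x); last by exists 0.
  have [l hl] : exists l, has_sum (part k x) l; last by exists l.
  apply: (@abs_sums_le_has_sum _ _ _ M).
  apply: abs_sums_le_mono (wiener_terms_le h hx) => al.
  by rewrite /part; case: ifP => _ //; rewrite normr0.
have [H hH] : exists H : nat -> 'rV[R]_n -> R, forall k x, in_box rho x ->
    has_sum (part k x) (H k x).
  have [H hH] := choice (fun k => ex_intro _ _ (projT2 (choice (ex k)))).
  by eexists; exact: hH.
exists H; split.
- move=> k r /andP[r_ge0 r_le].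
  exists (fun al => if mpoly.mdeg al == k then c al else 0); split=> [|x hx].
    have := abs_sums_leZ ((r / rho) ^+ k) h.
    have rr0 : 0 <= r / rho by rewrite divr_ge0// ltW.
    rewrite (ger0_norm (exprn_ge0 _ rr0)) [_ * M]mulrC.
    apply: abs_sums_le_mono => al; case: eqP => [->|_]; last by rewrite mul0r normr0.
    by rewrite mulrCA -exprMn divfK ?gt_eqF.
  apply: eq_has_sum (hH k x (in_box_le r_le hx)) => al.
  by rewrite /part; case: ifP => _ //; rewrite mul0r.
- move=> x hx.
  exact: (has_sum_fibers (wiener_terms_le h hx) (fun k => hH k x hx)).1.
- move=> x hx.
  by apply: (has_sum_fibers (wiener_terms_le h hx) (fun k => hH k x hx)).2; exact: hg.
- move=> k t x hx t1; apply: has_sum_unique (hH k _ (in_boxZ t1 hx)) _.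
  apply: eq_has_sum (has_sumZ (t ^+ k) (hH k x hx)) => al.
  rewrite /part; case: eqP => [<-|_]; last by rewrite mulr0.
  by rewrite monom_scale mulrCA.
Qed.

Lemma wiener_affine n m rho (b : 'rV[R]_n) (B : 'M[R]_(m, n)) i : 0 < rho ->
  wiener rho (`|b 0 i| + \sum_j `|B j i| * rho)
    (fun u : 'rV[R]_m => (b + u *m B) 0 i).
Proof.
move=> r0; have := wienerD (wiener_cst m (b 0 i) r0) (wiener_sum (index_enum 'I_m) r0
  (fun j => wienerZ (B j i) (wiener_coord j r0))).
by apply: eq_wiener => u _; rewrite !mxE; congr (_ + _); apply: eq_bigr => j _; rewrite mulrC.
Qed.

(** Re-expansion of a power series around another point, and passage to affine
    coordinates. *)
Lemma wiener_comp_affine n m r M (g : 'rV[R]_n -> R) (b : 'rV[R]_n)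
    (B : 'M[R]_(m, n)) :
  wiener r M g -> (forall i, `|b 0 i| < r) ->
  exists2 rho, 0 < rho & wiener rho M (fun u => g (b + u *m B)).
Proof.
move=> hg br.
pose S i := \sum_j `|B j i|.
have S0 i : 0 <= S i by apply: sumr_ge0.
pose e i := (r - `|b 0 i|) / (S i + 1).
have e0 i : 0 < e i by rewrite divr_gt0 ?subr_gt0// ltr_wpDl.
have [rho rho0 rhoe] : exists2 rho, 0 < rho & forall i, rho <= e i.
  exists (\big[Num.min/1]_i e i); last by move=> i; apply: bigmin_le_cond.
  by apply: lt_bigmin.
exists rho => //; apply: (wiener_comp rho0 hg (wiener_affine b B ^~ rho0)) => i.
rewrite -mulr_suml -lerBrDl; apply: le_trans (ler_wpM2l (S0 i) (rhoe i)) _.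
rewrite /e mulrA ler_pdivrMr ?ltr_wpDl// mulrC ler_wpM2l ?lerDl//.
by rewrite subr_ge0 ltW.
Qed.

Lemma wiener_shift n r M (g : 'rV[R]_n -> R) (b : 'rV[R]_n) :
  wiener r M g -> (forall i, `|b 0 i| < r) ->
  exists2 rho, 0 < rho & wiener rho M (fun u => g (b + u)).
Proof.
move=> hg /(wiener_comp_affine 1%:M hg)[rho r0 h]; exists rho => //.
by apply: eq_wiener h => u _; rewrite mulmx1.
Qed.

Lemma wiener_analytic n rho M (g : 'rV[R]_n -> R) a : 0 < rho ->
  wiener rho M (fun u => g (a + u)) -> analytic_at g a.
Proof.
move=> r0 [c [_ hg]]; exists c; apply/near_boxP; exists rho => // x /hg.
by rewrite (addrC a) subrK.
Qed.

(** Summability at the single point [(e, ..., e)] suffices, since no monomial is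
    larger elsewhere in the polydisc. *)
Lemma analytic_wiener n (g : 'rV[R]_n -> R) a : analytic_at g a ->
  exists2 rho, 0 < rho & exists M, wiener rho M (fun u => g (a + u)).
Proof.
move=> [c /near_boxP[e e0 h]]; exists e => //.
have /h : in_box e (a + const_mx e - a).
  by move=> i; rewrite addrC addKr mxE ger0_norm// ltW.
move=> /has_sum_abs_sums_le[M hM]; exists M, c; split.
  apply: abs_sums_le_mono hM => al; rewrite addrC addKr mpoly.mdegE -prodrXr.
  by rewrite /mpoly.mmap1; under [in leRHS]eq_bigr do rewrite mxE.
move=> u hu; have /h : in_box e (a + u - a) by rewrite addrC addKr.
by apply: eq_has_sum => al; rewrite addrC addKr.
Qed.

Lemma near_analytic n (g g' : 'rV[R]_n -> R) a :
  (\forall x \near a, g x = g' x) -> analytic_at g a -> analytic_at g' a.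
Proof.
move=> E [c h]; exists c; near=> x.
have <- : g x = g' x by near: x.
by near: x.
Unshelve. all: by end_near. Qed.

End Wiener.

(** * Power series in one variable *)

(** The expansion is only required on one side of the origin: the points of the
    set on the other side of a boundary point may be missing. *)
Definition ray_series (R : realType) (c : nat -> R) (phi : R -> R) :=
  exists2 rho, 0 < rho & exists M, abs_sums_le (fun k => c k * rho ^+ k) M /\
    forall t, 0 <= t <= rho -> has_sum (fun k => c k * t ^+ k) (phi t).

Definition line_series (R : realType) (c : nat -> R) (phi : R -> R) :=
  exists2 rho, 0 < rho & exists M, abs_sums_le (fun k => c k * rho ^+ k) M /\
    forall t, `|t| <= rho -> has_sum (fun k => c k * t ^+ k) (phi t).

Definition line_analytic (R : realType) (phi : R -> R) (t : R) :=
  exists c, line_series c (fun s => phi (t + s)).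

Section OneVariable.
Context {R : realType}.
Implicit Types (c : nat -> R) (phi psi : R -> R).

(** The first nonzero coefficient dominates the rest of the series near the
    origin, so it cannot exist if there are arbitrarily small zeros. *)
Lemma power_series_eq0 c rho M :
  0 < rho -> abs_sums_le (fun k => c k * rho ^+ k) M ->
  (forall d, 0 < d -> exists2 t, 0 < `|t| <= d & has_sum (fun k => c k * t ^+ k) 0) ->
  forall k, c k = 0.
Proof.
move=> r0 cM zeros k; have [n] := ubnP k; elim: n k => // n IH k kn.
have c0 j : (j < k)%N -> c j = 0 by move=> jk; apply: IH; apply: leq_trans jk _.
apply/eqP; apply/negP => /negP ck0.
have M0 : 0 < M + 1 by rewrite ltr_wpDl// (abs_sums_le_ge0 cM).
(* below this bound on [t], the terms of degree above [k], at most
     [(`|t| / rho) ^+ k.+1 * M] in total, cannot cancel the term of degree [k] *)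
pose d := Num.min rho (`|c k| * rho ^+ k.+1 / (M + 1)).
have d0 : 0 < d by rewrite lt_min r0 divr_gt0// mulr_gt0 ?normr_gt0// exprn_gt0.
have [t /andP[t0 td] ht] := zeros _ d0.
move: td; rewrite le_min => /andP[tr tc].
pose b j := if j == k then 0 else c j * t ^+ j.
have hk : has_sum (fun j => if j == k then c j * t ^+ j else 0) (c k * t ^+ k).
  have := @has_sum_finite _ _ (fun j => if j == k then c j * t ^+ j else 0) [:: k] isT.
  by rewrite big_seq1 eqxx; apply=> j; rewrite inE => /negbTE ->.
have hb : has_sum b (- (c k * t ^+ k)).
  rewrite -[X in has_sum _ X]add0r -mulN1r.
  apply: eq_has_sum (has_sumD ht (has_sumZ (-1) hk)) => j.
  by rewrite /b; case: eqP => _; rewrite mulN1r ?subrr// oppr0 addr0.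
have bM : abs_sums_le b ((`|t| / rho) ^+ k.+1 * M).
  have tr0 : 0 <= `|t| / rho by rewrite divr_ge0// ltW.
  rewrite -(ger0_norm (exprn_ge0 k.+1 tr0)).
  apply: abs_sums_le_mono (abs_sums_leZ _ cM) => j.
  rewrite /b; case: eqP => [_|/eqP jk]; first by rewrite normr0.
  have [jk'|kj|E] := ltngtP j k; last by rewrite E eqxx in jk.
    by rewrite c0// mul0r normr0.
  rewrite !normrM mulrCA ler_wpM2l// !normrX normrM normr_id normfV.
  rewrite (gtr0_norm r0) -(subnK kj) [X in _ <= _ * X]exprD mulrCA -exprMn divfK ?gt_eqF//.
  by rewrite exprD ler_wpM2r ?exprn_ge0// lerXn2r ?nnegrE// ltW.
have := has_sum_abs_le hb bM.
rewrite normrN normrM normrX exprMn exprS exprVn -!mulrA [leLHS]mulrC.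
rewrite (mulrCA `|t|) ler_pM2l ?exprn_gt0// => A.
have : `|c k| * rho ^+ k.+1 <= `|t| * M.
  by move: A; rewrite [_ * M]mulrC mulrA ler_pdivlMr ?exprn_gt0.
apply/negP; rewrite -ltNge; apply: (@lt_le_trans _ _ (`|t| * (M + 1))).
  by rewrite ltr_pM2l// ltrDl.
by rewrite -ler_pdivlMr.
Qed.

Lemma line_ray_series c phi : line_series c phi -> ray_series c phi.
Proof.
move=> [r r0 [M [h hc]]]; exists r => //; exists M; split=> // t /andP[t0 tr].
by apply: hc; rewrite ger0_norm.
Qed.

Lemma ray_series_unique c c' phi psi e :
  ray_series c phi -> ray_series c' psi -> 0 < e ->
  (forall t, 0 < t < e -> phi t = psi t) -> c = c'.
Proof.
move=> [r r0 [M [h hc]]] [r' r'0 [M' [h' hc']]] e0 E.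
pose s := Num.min r r'.
have s0 : 0 < s by rewrite lt_min r0.
have small N (b : nat -> R) x : 0 < x -> abs_sums_le (fun k => b k * x ^+ k) N ->
    s <= x -> abs_sums_le (fun k => b k * s ^+ k) N.
  move=> x0 H sx; apply: abs_sums_le_mono H => k.
  by rewrite !normrM ler_wpM2l// !normrX lerXn2r// !gtr0_norm.
suff D : forall k, c k + -1 * c' k = 0.
  by apply/funext => k; apply/eqP; rewrite -subr_eq0 -(D k) mulN1r.
apply: (power_series_eq0 (rho := s) (M := M + `|-1| * M')) => //.
  have A := small _ _ _ r0 h; have B := small _ _ _ r'0 h'.
  apply: abs_sums_le_mono (abs_sums_leD (A _) (abs_sums_leZ (-1) (B _))) => [k||].
  - by rewrite mulrDl mulrA.
  - by rewrite ge_min lexx.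
  - by rewrite ge_min lexx orbT.
move=> d d0; pose t := Num.min (e / 2) (Num.min s d).
have t0 : 0 < t by rewrite lt_min divr_gt0//= lt_min s0.
have te : t < e by rewrite gt_min ltr_pdivrMr// ltr_pMr// ltr1n.
have tr : t <= r by rewrite !ge_min lexx !orbT.
have tr' : t <= r' by rewrite !ge_min lexx !orbT.
exists t.
  by rewrite gtr0_norm// t0 !ge_min lexx !orbT.
have /hc H : 0 <= t <= r by rewrite ltW.
have /hc' H' : 0 <= t <= r' by rewrite ltW.
have := has_sumD H (has_sumZ (-1) H').
rewrite E ?t0 ?te// mulN1r subrr; apply: eq_has_sum => k.
by rewrite mulrDl mulrA.
Qed.

Lemma ray_series_rescale c phi s :
  0 < s -> ray_series c phi ->
  ray_series (fun k => s ^+ k * c k) (fun t => phi (t * s)).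
Proof.
move=> s0 [r r0 [M [h hc]]]; exists (r / s); first by rewrite divr_gt0.
exists M; split=> [|t /andP[t0 tr]].
  apply: abs_sums_le_mono h => k.
  by rewrite mulrAC -exprMn mulrC [s * _]mulrC divfK ?gt_eqF.
have /hc : 0 <= t * s <= r by rewrite (mulr_ge0 t0 (ltW s0)) -ler_pdivlMr.
by apply: eq_has_sum => k; rewrite exprMn mulrC -mulrA mulrC -mulrA.
Qed.

(** The bound depends on a single natural number, so that countably many conditions
    exhaust all coefficient sequences, as Baire's theorem requires. *)
Lemma ray_series_bound c phi :
  ray_series c phi -> exists N : nat, forall k, `|c k| <= N%:R ^+ k.+1.
Proof.
move=> [r r0 [M [h _]]].
have [N hN] : exists N : nat, Num.max M r^-1 <= N%:R.
  by exists (Num.truncn (Num.max M r^-1)).+1; rewrite ltW// truncnS_gt.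
move: hN; rewrite ge_max => /andP[MN rN]; exists N => k.
have := abs_sums_le_term k h; rewrite normrM (gtr0_norm (exprn_gt0 k r0)).
rewrite -ler_pdivlMr ?exprn_gt0// => /le_trans; apply.
rewrite exprS -exprVn; apply: ler_pM => //.
- exact: abs_sums_le_ge0 h.
- by rewrite exprn_ge0// invr_ge0 ltW.
- by rewrite lerXn2r// nnegrE ?invr_ge0// ltW.
Qed.

Lemma line_analyticB phi psi t : line_analytic phi t -> line_analytic psi t ->
  line_analytic (fun s => phi s - psi s) t.
Proof.
move=> [c [r r0 [M [h hc]]]] [c' [r' r'0 [M' [h' hc']]]].
pose s := Num.min r r'.
have s0 : 0 < s by rewrite lt_min r0.
have sr : s <= r by rewrite ge_min lexx.
have sr' : s <= r' by rewrite ge_min lexx orbT.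
exists (fun k => c k + -1 * c' k); exists s => //; exists (M + `|-1| * M').
have small N (b : nat -> R) x : 0 < x -> abs_sums_le (fun k => b k * x ^+ k) N ->
    s <= x -> abs_sums_le (fun k => b k * s ^+ k) N.
  move=> x0 H sx; apply: abs_sums_le_mono H => k.
  by rewrite !normrM ler_wpM2l// !normrX lerXn2r// !gtr0_norm.
split=> [|u us].
  have A := small _ _ _ r0 h sr; have B := small _ _ _ r'0 h' sr'.
  apply: abs_sums_le_mono (abs_sums_leD A (abs_sums_leZ (-1) B)) => k.
  by rewrite mulrDl mulrA.
have H := hc u (le_trans us sr); have H' := hc' u (le_trans us sr').
have := has_sumD H (has_sumZ (-1) H'); rewrite mulN1r; apply: eq_has_sum => k.
by rewrite mulrDl mulrA.
Qed.

Lemma line_series_eq0 c phi : line_series c phi ->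
  (forall d, 0 < d -> exists2 t, 0 < `|t| <= d & phi t = 0) ->
  exists2 d, 0 < d & forall t, `|t| <= d -> phi t = 0.
Proof.
move=> [r r0 [M [h hc]]] zeros.
have c0 : forall k, c k = 0.
  apply: (power_series_eq0 r0 h) => d d0.
  have [|t /andP[t0 td] ft] := zeros (Num.min d r); first by rewrite lt_min d0.
  move: td; rewrite le_min => /andP[td tr].
  by exists t; [rewrite t0|rewrite -ft; exact: hc].
exists r => // t /hc/has_sum_unique; apply; apply: has_sum0 => k.
by rewrite c0 mul0r.
Qed.

(** The supremum of the times up to which [phi] vanishes is approached by zeros, so
    [phi] vanishes around it, and it must be 1. *)
Lemma line_analytic_eq0 phi e :
  (forall t, 0 <= t <= 1 -> line_analytic phi t) -> 0 < e ->
  (forall t, 0 <= t < e -> phi t = 0) -> phi 1 = 0.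
Proof.
move=> an e0 zero.
pose S := [set t : R | 0 <= t <= 1 /\ forall s, 0 <= s <= t -> phi s = 0].
pose t0 := Num.min (e / 2) 1.
have t0_gt0 : 0 < t0 by rewrite lt_min divr_gt0/=.
have St0 : S t0.
  split; first by rewrite (ltW t0_gt0)/= ge_min lexx orbT.
  move=> s /andP[s0 st]; apply: zero; rewrite s0/= (le_lt_trans st)//.
  by rewrite gt_min ltr_pdivrMr// ltr_pMr// ltr1n.
have ubS : ubound S 1 by move=> t [/andP[_]].
have supS : has_sup S by split; [exists t0|exists 1].
set T := sup S.
have T0 : 0 < T by apply: lt_le_trans t0_gt0 _; exact: (sup_upper_bound supS).
have T1 : T <= 1 by apply: ge_sup => //; exists t0.
have below s : 0 <= s < T -> phi s = 0.
  move=> /andP[s0 sT].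
  have [t [_ St] st] := sup_gt (ex_intro _ _ St0) sT.
  by apply: St; rewrite s0 ltW.
have [c hc] := an T ltac:(by rewrite (ltW T0) T1).
have [|d d0 hd] := line_series_eq0 hc.
  move=> d d0; exists (- Num.min d T).
    by rewrite normrN gtr0_norm ?lt_min ?d0 ?T0// ge_min lexx.
  by apply: below; rewrite subr_ge0 ge_min lexx orbT/= gtrBl lt_min d0 T0.
have upto s : 0 <= s <= T + d -> phi s = 0.
  move=> /andP[s0 sT]; have [sT'|Ts] := ltP s T; first by apply: below; rewrite s0.
  have := hd (s - T); rewrite (addrC T) subrK; apply.
  by rewrite ger0_norm ?subr_ge0// lerBlDl.
have [h|h] := leP 1 (T + d); first by apply: upto; rewrite ler01.
have : T + d <= T.
  apply: (sup_upper_bound supS); split=> //.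
  by rewrite (ltW h) addr_ge0// ltW.
by rewrite gerDl leNgt d0.
Qed.

Lemma wiener_line_series n rho M (g : 'rV[R]_n -> R) v :
  0 < rho -> wiener rho M g -> exists c, line_series c (fun t => g (t *: v)).
Proof.
move=> r0 hg; have [H [_ HM Hg Ht]] := wiener_homogeneous r0 hg.
have [s s0 sv] : exists2 s, 0 < s & in_box rho (s *: v).
  pose S := \sum_i `|v 0 i| + 1.
  have S0 : 0 < S by rewrite ltr_wpDl// sumr_ge0.
  exists (rho / S) => [|i]; first by rewrite divr_gt0.
  rewrite mxE normrM gtr0_norm ?divr_gt0// mulrAC ler_pdivrMr// ler_pM2l//.
  by rewrite /S (bigD1 i)//= -addrA lerDl addr_ge0// sumr_ge0.
exists (fun k => H k (s *: v) / s ^+ k), s => //; exists M; split=> [|t ts].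
  by apply: abs_sums_le_mono (HM _ sv) => k; rewrite divfK// expf_neq0// gt_eqF.
have t1 : `|t / s| <= 1 by rewrite normrM normfV (gtr0_norm s0) ler_pdivrMr// mul1r.
have := Hg _ (in_boxZ t1 sv); rewrite [X in g X]scalerA divfK ?gt_eqF//.
by apply: eq_has_sum => k; rewrite Ht// expr_div_n mulrC mulrA mulrAC.
Qed.

End OneVariable.

(** * Interpolation of separately polynomial functions *)

(** Written as a motion along a coordinate line, which makes its continuity and its
    relation to segments immediate. *)
Definition set_coord (R : realType) (n : nat) (x : 'rV[R]_n) (i : 'I_n) (t : R) :=
  x + (t - x 0 i) *: delta_mx 0 i.

(** The polynomials are only prescribed on the positive half-lines, because the
    functions of interest are only defined on an orthant. *)
Definition separately_poly (R : realType) (n k : nat) (G : 'rV[R]_n -> R) :=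
  forall x : 'rV[R]_n, (forall i, 0 < x 0 i) -> forall i, exists2 q : {poly R},
    (size q <= k.+1)%N & forall t, 0 < t -> G (set_coord x i t) = q.[t].

(** Dividing by [k.+1] rather than [k] keeps the nodes well defined for constant
    polynomials. *)
Definition box_node (R : realType) (n k : nat) (b : 'rV[R]_n) (d : R)
    (i : 'I_n) (j : 'I_k.+1) : R := b 0 i + d * (j%:R / k.+1%:R).

Lemma leq_bin_exp n m : ('C(n, m) <= 2 ^ n)%N.
Proof.
elim: n m => [|n IH] [|m]; rewrite ?bin0 ?bin0n ?expn_gt0//.
by rewrite binS expnS mul2n -addnn leq_add.
Qed.

Lemma leq_expSk_fact k : (k.+1 ^ k <= 4 ^ k * k`!)%N.
Proof.
(* 'C(2k, k) * k! is the product of the [k] numbers from [k.+1] to [2k] *)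
apply: (@leq_trans ('C(k.*2, k) * k`!)); last first.
  rewrite leq_mul2r; apply/orP; right.
  by rewrite (leq_trans (leq_bin_exp _ _))// -mul2n expnM.
rewrite bin_ffact ffact_prod -[X in (_ ^ X)%N](card_ord k) -prod_nat_const.
by apply: leq_prod => -[i ik] _ /=; lia.
Qed.

Section Interpolation.
Context {R : realType}.

Lemma set_coordE n (x : 'rV[R]_n) i t j :
  set_coord x i t 0 j = if j == i then t else x 0 j.
Proof.
rewrite !mxE eqxx /=; case: eqP => [->|_]; last by rewrite mulr0 addr0.
by rewrite mulr1 addrC subrK.
Qed.

Lemma set_coord_id n (x : 'rV[R]_n) i : set_coord x i (x 0 i) = x.
Proof. by rewrite /set_coord subrr scale0r addr0. Qed.

Lemma set_coord_continuous n (i : 'I_n) t :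
  continuous (fun x : 'rV[R]_n => set_coord x i t).
Proof.
move=> x; apply: (@cvgD _ _ _ (nbhs x) _ id); first exact: cvg_id.
apply: (@cvgZr_tmp _ _ _ (nbhs x)); apply: cvgB; first exact: cvg_cst.
exact: coord_continuous.
Qed.

Lemma lagrange_interpolation k (y : 'I_k.+1 -> R) (q : {poly R}) t :
  injective y -> (size q <= k.+1)%N ->
  q.[t] = \sum_j q.[y j] * \prod_(m | m != j) ((t - y m) / (y j - y m)).
Proof.
move=> yI qk.
pose L j : {poly R} := \prod_(m | m != j) ((y j - y m)^-1 *: ('X - (y m)%:P)).
pose p := \sum_j q.[y j] *: L j.
have LE j u : (L j).[u] = \prod_(m | m != j) ((u - y m) / (y j - y m)).
  rewrite horner_prod; apply: eq_bigr => m _.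
  by rewrite hornerZ hornerXsubC mulrC.
have pE u : p.[u] = \sum_j q.[y j] * \prod_(m | m != j) ((u - y m) / (y j - y m)).
  by rewrite horner_sum; apply: eq_bigr => j _; rewrite hornerZ LE.
rewrite -pE; suff -> : q = p by [].
apply/eqP; rewrite -subr_eq0; apply/eqP.
apply: (@roots_geq_poly_eq0 _ _ [seq y j | j <- enum 'I_k.+1]).
- apply/allP => _ /mapP[j _ ->]; rewrite rootE hornerD hornerN pE (bigD1 j)//=.
  rewrite [X in _ - (_ + X)]big1 => [|m mj]; last first.
    by rewrite (bigD1 j) 1?eq_sym//= subrr !mul0r mulr0.
  rewrite big1 ?mulr1 ?addr0 ?subrr// => m mj.
  by rewrite divff// subr_eq0 (inj_eq yI) eq_sym.
- by rewrite map_inj_uniq ?enum_uniq.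
- rewrite size_map size_enum_ord; apply: leq_trans (size_polyD _ _) _.
  rewrite size_polyN geq_max qk /=; apply: leq_trans (size_sum _ _ _) _.
  apply/bigmax_leqP => j _; apply: leq_trans (size_scale_leq _ _) _.
  apply: leq_trans (size_prod_leq _ _) _.
  rewrite leq_subLR; apply: (@leq_trans (\sum_(m : 'I_k.+1 | m != j) 2).+1).
    by rewrite ltnS; apply: leq_sum => m _; apply: leq_trans (size_scale_leq _ _) _; rewrite size_XsubC.
  rewrite sum_nat_const cardC1 card_ord /=; lia.
Qed.

(** The coordinates listed in [s] are interpolated one after the other, the
    remaining ones being frozen at nodes, so the values of [G] only enter at points
    of the grid. *)
Lemma interpolation_step n k (y : 'I_n -> 'I_k.+1 -> R) (B N : R)
    (G : 'rV[R]_n -> R) :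
  (forall i j, 0 < y i j <= 1) -> (forall i, injective (y i)) ->
  (forall i j, wiener 1 B
     (fun x : 'rV[R]_n => \prod_(m | m != j) ((x 0 i - y i m) / (y i j - y i m)))) ->
  separately_poly k G ->
  (forall x : 'rV[R]_n, (forall i, exists j, x 0 i = y i j) -> `|G x| <= N) ->
  forall (s : seq 'I_n) (x : 'rV[R]_n), (forall i, 0 < x 0 i) ->
    (forall i, i \notin s -> exists j, x 0 i = y i j) ->
  exists Q : 'rV[R]_n -> R, [/\ continuous Q, wiener 1 ((k.+1%:R * B) ^+ size s * N) Q &
    forall x' : 'rV[R]_n, (forall i, 0 < x' 0 i) -> (forall i, i \notin s -> x' 0 i = x 0 i) ->
      G x' = Q x'].
Proof.
move=> y01 yI LB Gpoly GN; elim=> [|i s IH] x x0 xs.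
  exists (fun=> G x); split; first exact: cst_continuous.
    rewrite mul1r; apply: wiener_norm_le (wiener_cst _ _ ltr01).
    by apply: GN => i; exact: xs.
  move=> x' _ x's; congr G; apply/matrixP => j i; rewrite ord1; exact: x's.
have upd0 (z : 'rV[R]_n) j : (forall i, 0 < z 0 i) -> forall i', 0 < set_coord z i (y i j) 0 i'.
  by move=> z0 i'; rewrite set_coordE; case: ifP => // _; have /andP[] := y01 i j.
have exQ j : exists Q : 'rV[R]_n -> R, [/\ continuous Q, wiener 1 ((k.+1%:R * B) ^+ size s * N) Q &
    forall x' : 'rV[R]_n, (forall i, 0 < x' 0 i) ->
      (forall i', i' \notin s -> x' 0 i' = set_coord x i (y i j) 0 i') -> G x' = Q x'].
  apply: IH => [|i' i's]; first exact: upd0.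
  rewrite set_coordE; case: eqP => [->|/eqP ii']; first by exists j.
  by apply: xs; rewrite inE negb_or ii'.
have {exQ}[Q HQ] := choice exQ.
exists (fun x' => \sum_j Q j (set_coord x' i (y i j)) *
  \prod_(m | m != j) ((x' 0 i - y i m) / (y i j - y i m))); split.
- move=> z; apply: (@cvg_big _ _ _ _ _ _ _ (nbhs z)); first exact: add_continuous.
  move=> j _; apply: (cvgM (F := nbhs z)).
    have [Qc _ _] := HQ j.
    by apply: (@continuous_comp _ _ _ (fun x => set_coord x i (y i j)) (Q j));
      [exact: set_coord_continuous|exact: Qc].
  apply: (@cvg_big _ _ _ _ _ _ _ (nbhs z)); first exact: mul_continuous.
  move=> m _; apply: (cvgM (F := nbhs z)); last exact: cvg_cst.
  by apply: (cvgB (F := nbhs z)); [exact: coord_continuous|exact: cvg_cst].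
- have -> : (k.+1%:R * B) ^+ size (i :: s) * N =
     \sum_(j < k.+1) (k.+1%:R * B) ^+ size s * N * B.
    by rewrite sumr_const card_ord -mulr_natl /= exprS; ring.
  apply: wiener_sum => // j; apply: wienerM => //; have [_ Qw _] := HQ j.
  pose r i' := if i' == i then `|y i j| else 1 : R.
  apply: (@wiener_comp _ _ _ 1 1 _ r (Q j)) => // i'.
    rewrite /r; have [->|/negbTE ii'] := eqVneq i' i.
      by apply: eq_wiener (wiener_cst _ _ ltr01) => u _; rewrite set_coordE eqxx.
    by apply: eq_wiener (wiener_coord i' ltr01) => u _; rewrite set_coordE ii'.
  rewrite /r; case: ifP => // _; have /andP[y0 y1] := y01 i j.
  by rewrite gtr0_norm.
- move=> x' x'0 x's.
  have [q qk qE] := Gpoly x' x'0 i.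
  rewrite -{1}(set_coord_id x' i) qE// (lagrange_interpolation _ (yI i) qk).
  apply: eq_bigr => j _; congr (_ * _).
  have /andP[yj0 _] := y01 i j; rewrite -qE//.
  have [_ _ ->] := HQ j; [by []|exact: upd0|].
  move=> i' i's; rewrite !set_coordE; case: eqP => [//|/eqP ii'].
  by apply: x's; rewrite inE negb_or ii'.
Qed.


Lemma prod_dist_fact k (j : 'I_k.+1) :
  \prod_(m < k.+1 | m != j) `|j%:R - m%:R : R| = (j`! * (k - j)`!)%:R.
Proof.
have E : \prod_(m < k.+1 | m != j) `|j%:R - m%:R : R| =
    \prod_(0 <= m < k.+1 | m != j :> nat) `|j%:R - m%:R|.
  by rewrite big_mkord.
have jk := ltn_ord j.
have j0 : (0 <= j)%N by [].
rewrite E (big_cat_nat j0 (ltnW jk)) /= [X in _ * X]big_ltn_cond// eqxx /=.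
rewrite natrM !fact_prod !natr_prod !big_add1 /=; congr (_ * _).
  rewrite big_nat_rev /= big_nat_cond [RHS]big_nat_cond.
  apply: eq_big => [m|m /andP[/andP[_ mj] _]]; first by lia.
  by rewrite add0n natrB// opprB addrC subrK ger0_norm.
rewrite -[X in index_iota X]add0n big_addn big_nat_cond [RHS]big_nat_cond.
apply: eq_big => [m|m _]; first by lia.
by rewrite -normrN opprB -natrB ?ger0_norm//; [congr _%:R|]; lia.
Qed.

(** Equally spaced nodes lose only an exponential factor, of the same kind as
    the one lost by changing the radius of convergence. *)
Lemma lagrange_wiener n k (b : 'rV[R]_n) d i (j : 'I_k.+1) :
  0 < d -> 0 < b 0 i -> b 0 i + d <= 1 ->
  wiener 1 ((16 / d) ^+ k) (fun x : 'rV[R]_n =>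
    \prod_(m | m != j) ((x 0 i - box_node b d i m) / (box_node b d i j - box_node b d i m))).
Proof.
move=> d0 b0 bd; set y := box_node b d i.
have k0 : 0 < k.+1%:R :> R by [].
have yB m : y j - y m = d / k.+1%:R * (j%:R - m%:R).
  by rewrite /y /box_node; field; rewrite addrC natr1 gt_eqF.
have y1 m : `|y m| <= 1.
  have mk : m%:R / k.+1%:R <= 1 :> R by rewrite ler_pdivrMr// mul1r ler_nat ltnW.
  have mk0 : 0 <= m%:R / k.+1%:R :> R by rewrite divr_ge0.
  have y0 : 0 <= y m by rewrite addr_ge0 ?(ltW b0)// mulr_ge0// ltW.
  rewrite (ger0_norm y0).
  by apply: le_trans _ bd; rewrite lerD2l ler_piMr// ltW.
pose N m := `|(y j - y m)^-1| * (1 + `|- y m|).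
apply: (@wiener_norm_le _ _ _ (\prod_(m | m != j) N m)).
  have jf : 0 < (j`! * (k - j)`!)%:R :> R by rewrite ltr0n muln_gt0 !fact_gt0.
  apply: (@le_trans _ _ (\prod_(m < k.+1 | m != j) (2 * k.+1%:R / d / `|j%:R - m%:R|))).
    apply: ler_prod => m mj; rewrite mulr_ge0//= /N yB normfV normrM gtr0_norm ?divr_gt0//.
    rewrite normrN invfM invfM invrK mulrC.
    have -> : 2 * k.+1%:R / d / `|j%:R - m%:R| = 2 * (k.+1%:R / d / `|j%:R - m%:R| : R).
      by rewrite !mulrA.
    rewrite [d^-1 * _]mulrC ler_wpM2r//; last by rewrite -[leRHS]/(1 + 1) lerD2l.
    by rewrite divr_ge0// divr_ge0// ltW.
  rewrite big_split /= prodr_const cardC1 card_ord /= prodfV prod_dist_fact.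
  rewrite ler_pdivrMr// !expr_div_n mulrAC ler_pM2r ?invr_gt0 ?exprn_gt0//.
  rewrite exprMn -!natrX -!natrM ler_nat.
  have := leq_expSk_fact k; rewrite -(bin_fact (ltn_ord j : (j <= k)%N)).
  rewrite mulnA [(4 ^ k * _)%N]mulnC -mulnA => /leq_trans.
  move=> /(_ (2 ^ k * (4 ^ k * (j`! * (k - j)`!)))%N).
  rewrite leq_mul2r leq_bin_exp orbT => /(_ isT) A.
  apply: leq_trans (leq_mul (leqnn (2 ^ k)%N) A) _.
  by rewrite !mulnA -!expnMn.
apply: wiener_prod => // m; rewrite /N.
have := wienerZ (y j - y m)^-1 (wienerD (wiener_coord i ltr01) (wiener_cst n (- y m) ltr01)).
by apply: eq_wiener => x _; rewrite mulrC.
Qed.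

(** On the open orthant a separately polynomial function is a polynomial, whose norm
    is controlled by the values on a grid inside any box of the unit cube. *)
Lemma box_interpolation n k (b : 'rV[R]_n) (d N : R) (G : 'rV[R]_n -> R) :
  0 < d -> (forall i, 0 < b 0 i) -> (forall i, b 0 i + d <= 1) ->
  separately_poly k G ->
  (forall x : 'rV[R]_n, (forall i, exists j : 'I_k.+1, x 0 i = box_node b d i j) ->
     `|G x| <= N) ->
  exists Q : 'rV[R]_n -> R,
    [/\ continuous Q, wiener 1 ((k.+1%:R * (16 / d) ^+ k) ^+ n * N) Q &
    forall x : 'rV[R]_n, (forall i, 0 < x 0 i) -> G x = Q x].
Proof.
move=> d0 b0 bd Gpoly GN.
have k0 : 0 < k.+1%:R :> R by [].
have node i (j : 'I_k.+1) : 0 < box_node b d i j <= 1.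
  have jk0 : 0 <= j%:R / k.+1%:R :> R by rewrite divr_ge0.
  rewrite /box_node ltr_pwDl ?mulr_ge0// ?(ltW d0)//=.
  apply: le_trans _ (bd i); rewrite lerD2l ler_piMr ?(ltW d0)//.
  by rewrite ler_pdivrMr// mul1r ler_nat ltnW.
have nodeI i : injective (@box_node R n k b d i).
  move=> j m /addrI /(mulfI (lt0r_neq0 d0)) /(mulIf (invr_neq0 (lt0r_neq0 k0))).
  by move=> /eqP; rewrite eqr_nat => /eqP/val_inj.
have [|i|Q [Qc Qw QG]] := interpolation_step node nodeI
  (fun i j => lagrange_wiener j d0 (b0 i) (bd i)) Gpoly GN (s := enum 'I_n) (x := b).
- by [].
- by rewrite mem_enum.
exists Q; split=> //; first by rewrite size_enum_ord in Qw.
by move=> x x0; apply: QG => // i; rewrite mem_enum.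
Qed.

End Interpolation.

(** * Expansion at a corner *)

Definition analytic_along (R : realType) (n : nat) (g : 'rV[R]_n -> R) (p : 'rV[R]_n) :=
  forall v, exists c, line_series c (fun s => g (p + s *: v)).

(** Row vectors form a complete normed module, the setting of Baire's theorem. *)
HB.instance Definition _ (R : realType) (n : nat) := Complete.on 'rV[R]_n.

Section Along.
Context {R : realType} {n : nat}.
Implicit Types (g : 'rV[R]_n -> R) (p x y v : 'rV[R]_n).

Lemma eq_line_series c (phi psi : R -> R) :
  phi =1 psi -> line_series c phi -> line_series c psi.
Proof. by move=> /funext ->. Qed.

Lemma eq_ray_series c (phi psi : R -> R) :
  phi =1 psi -> ray_series c phi -> ray_series c psi.
Proof. by move=> /funext ->. Qed.

Lemma wiener_along r M g p :
  wiener r M g -> (forall i, `|p 0 i| < r) -> analytic_along g p.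
Proof.
move=> hg pr v; have [rho r0 h] := wiener_shift hg pr.
exact: wiener_line_series r0 h.
Qed.

(** The identity theorem on a segment only needs expansions along the segment, not
    analyticity in several variables. *)
Lemma segment_identity g g' y x e :
  (forall t, 0 <= t <= 1 -> analytic_along g (y + t *: (x - y))) ->
  (forall t, 0 <= t <= 1 -> analytic_along g' (y + t *: (x - y))) ->
  0 < e ->
  (forall t, 0 <= t < e -> g (y + t *: (x - y)) = g' (y + t *: (x - y))) ->
  g x = g' x.
Proof.
move=> ag ag' e0 E.
pose phi t := g (y + t *: (x - y)) - g' (y + t *: (x - y)).
have along f t : analytic_along f (y + t *: (x - y)) ->
    line_analytic (fun t => f (y + t *: (x - y))) t.
  move=> /(_ (x - y))[c hc]; exists c; apply: eq_line_series hc => s.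
  by rewrite scalerDl addrA.
apply/eqP; rewrite -subr_eq0; apply/eqP.
suff : phi 1 = 0 by rewrite /phi scale1r (addrC y) subrK.
apply: (@line_analytic_eq0 _ phi e) => // t t01.
  by apply: line_analyticB; apply: along; [exact: ag|exact: ag'].
by rewrite /phi E// subrr.
Qed.

End Along.

Section Corner.
Context {R : realType} {n : nat} (h : 'rV[R]_n -> R).

(** What quadratic plots provide: on the quadrant spanned by [a] and [b], the
    function [h] is a double power series, so that along the ray of slope [u] its
    coefficient of degree [k] is a polynomial of degree at most [k] in [u]. *)
Hypothesis ray_poly : forall a b : 'rV[R]_n,
  (forall i, 0 <= a 0 i) -> (forall i, 0 <= b 0 i) ->
  exists e : nat -> nat -> R, forall u, 0 <= u ->
    ray_series (fun k => \sum_(j < k.+1) e k j * u ^+ j)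
      (fun t => h (t *: (a + u *: b))).

(** The coefficients [G k x] of [h] along the ray through [x] are studied as
    functions of [x]: they are the candidates for the homogeneous parts of the
    expansion of [h] at the corner. *)
Lemma ray_coefs : exists G : nat -> 'rV[R]_n -> R,
  forall x : 'rV[R]_n, (forall i, 0 <= x 0 i) -> ray_series (G ^~ x) (fun t => h (t *: x)).
Proof.
have ex (x : 'rV[R]_n) : exists c : nat -> R,
    (forall i, 0 <= x 0 i) -> ray_series c (fun t => h (t *: x)).
  have [x0|x0] := pselect (forall i, 0 <= x 0 i); last by exists (fun=> 0).
  have [e he] := ray_poly x0 x0; eexists => _.
  by apply: eq_ray_series (he 0 (lexx _)) => t; rewrite scale0r addr0.
have [c hc] := choice ex.
by exists (fun k x => c x k) => x x0; exact: hc.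
Qed.

Variable G : nat -> 'rV[R]_n -> R.
Hypothesis G_ray : forall x : 'rV[R]_n, (forall i, 0 <= x 0 i) ->
  ray_series (G ^~ x) (fun t => h (t *: x)).

(** Changing one coordinate of [x] moves it along a half-line [a + t *: e_i] inside
    the closed orthant. *)
Lemma ray_coefs_separately_poly k : separately_poly k (G k).
Proof.
move=> x x0 i.
pose a := x - x 0 i *: delta_mx 0 i.
have a0 j : 0 <= a 0 j.
  rewrite !mxE eqxx /=; case: eqP => [->|_]; first by rewrite mulr1 subrr.
  by rewrite mulr0 subr0 ltW.
have b0 j : 0 <= (delta_mx 0 i : 'rV[R]_n) 0 j by rewrite mxE ler0n.
have [e he] := ray_poly a0 b0.
exists (\poly_(j < k.+1) e k j) => [|t t0]; first exact: size_poly.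
have E : set_coord x i t = a + t *: delta_mx 0 i.
  by rewrite /set_coord /a scalerBl addrA addrAC.
have s0 j : 0 <= set_coord x i t 0 j by rewrite set_coordE; case: ifP => _; apply: ltW.
have := ray_series_unique (G_ray s0) (he t (ltW t0)) ltr01.
move=> /(_ _)/(congr1 (fun c => c k)) ->; last by move=> u _; rewrite E.
by rewrite horner_poly.
Qed.

Lemma ray_coefs_homogeneous k s (x : 'rV[R]_n) :
  0 < s -> (forall i, 0 <= x 0 i) -> G k (s *: x) = s ^+ k * G k x.
Proof.
move=> s0 x0.
have sx0 i : 0 <= (s *: x) 0 i by rewrite mxE mulr_ge0// ltW.
have := ray_series_unique (G_ray sx0) (ray_series_rescale s0 (G_ray x0)) ltr01.
move=> /(_ _)/(congr1 (fun c => c k)) -> // t _.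
by rewrite scalerA.
Qed.

(** Continuity comes from interpolation on an arbitrary grid; it makes the sets to
    which Baire's theorem is applied closed. *)
Lemma ray_coefs_continuous k : exists Q : 'rV[R]_n -> R,
  continuous Q /\ forall x : 'rV[R]_n, (forall i, 0 < x 0 i) -> G k x = Q x.
Proof.
pose b : 'rV[R]_n := const_mx 4^-1.
pose N := \sum_(J : {ffun 'I_n -> 'I_k.+1}) `|G k (\row_i box_node b 2^-1 i (J i))|.
have [|i|i|||Q [Qc _ QG]] := @box_interpolation R n k b 2^-1 N (G k).
- by [].
- by rewrite mxE.
- by rewrite mxE; lra.
- exact: ray_coefs_separately_poly.
- move=> x /choice[J hJ]; rewrite /N (bigD1 (finfun J))//=.
  rewrite (_ : \row_i _ = x); first by rewrite lerDl sumr_ge0.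
  by apply/matrixP => i j; rewrite mxE ffunE ord1 hJ.
by exists Q.
Qed.

(** At each point the coefficients grow at most exponentially; by Baire's
    theorem they do so uniformly on some box. *)
Lemma ray_coefs_uniform_bound : exists (N : nat) (b : 'rV[R]_n) (d : R),
  [/\ 0 < d, forall i, 0 < b 0 i, forall i, b 0 i + d <= 1 &
   forall x : 'rV[R]_n, (forall i, b 0 i <= x 0 i <= b 0 i + d) ->
     forall k, `|G k x| <= N%:R ^+ k.+1].
Proof.
have [Q HQ] := choice ray_coefs_continuous.
pose K := \bigcap_(i : 'I_n) ((fun x : 'rV[R]_n => x 0 i) @^-1` `[4^-1, 3 / 4]).
pose C (N : nat) := K `&`
  \bigcap_k (Q k @^-1` [set y | `|y| <= N%:R ^+ k.+1]).
have Kpos x : K x -> forall i, 0 < x 0 i.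
  by move=> Kx i; have /= := Kx i I; rewrite in_itv/= => /andP[+ _]; lra.
have Cclosed N : closed (C N).
  apply: closedI; apply: closed_bigI => i _; apply: closed_comp.
  - by move=> x _; exact: coord_continuous.
  - exact: itv_closed.
  - by move=> x _; have [+ _] := HQ i; apply.
  - rewrite (_ : [set y | _] = (fun y : R => `|y|) @^-1` [set y : R | y <= N%:R ^+ i.+1])//.
    apply: closed_comp; last exact: closed_le.
    by move=> x _; exact: norm_continuous.
have [N notdense] : exists N, ~ dense (~` C N).
  apply: contrapT => /forallNP H.
  have openC N : open (~` C N) /\ dense (~` C N).
    by split; [exact: closed_openC|apply: contrapT; exact: H].
  have [||x [xb xC]] := @Baire R 'rV[R]_n (fun N => ~` C N) openC
    (ball (const_mx 2^-1 : 'rV[R]_n) 4^-1).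
  - by exists (const_mx 2^-1 : 'rV[R]_n); apply: ballxx.
  - by apply: ball_open.
  have Kx : K x.
    move=> i _ /=; have := xb.2 0 i; rewrite /ball/= mxE in_itv/= ltr_norml => /andP[A B].
    by apply/andP; split; lra.
  have x0 := Kpos _ Kx.
  have [N hN] := ray_series_bound (G_ray (fun i => ltW (x0 i))).
  apply: (xC N I); split=> // k _ /=; have [_ <-//] := HQ k.
have [V [[x0 Vx0] Vopen VC]] : exists V : set 'rV[R]_n, [/\ V !=set0, open V & V `<=` C N].
  apply: contrapT => /forallNP H; apply: notdense => V V0 Vo.
  apply: contrapT => /forallNP VC; apply: (H V); split=> // x Vx.
  by apply: contrapT => Cx; apply: (VC x).
have [e e0 he] : exists2 e, 0 < e & forall x, in_box e (x - x0) -> C N x.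
  by apply/near_boxP; apply: filterS VC _; apply: open_nbhs_nbhs.
have Kx0 : K x0 by have [] := VC _ Vx0.
exists N, x0, (Num.min e 4^-1).
have d0 : 0 < Num.min e 4^-1 by rewrite lt_min e0/=.
split=> // [i|i|x xb k].
- exact: Kpos.
- have /= := Kx0 i I; rewrite in_itv/= => /andP[_ A].
  have : Num.min e 4^-1 <= 4^-1 by rewrite ge_min lexx orbT.
  by lra.
have [|Kx Cx] := he x.
  move=> i; rewrite !mxE; have /andP[A B] := xb i.
  rewrite ger0_norm ?subr_ge0// lerBlDl (le_trans B)// lerD2l.
  by rewrite ge_min lexx.
have [_ ->] := HQ k; last exact: Kpos.
exact: (Cx k I).
Qed.

(** [G k] is homogeneous of degree [k], so on the orthant the polynomial [Q] reduces
    to its part of degree [k]; the norm of that part shrinks like [r ^+ k]. *)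
Lemma homogeneous_part_of_ray_coefs k M (Q : 'rV[R]_n -> R) :
  wiener 1 M Q -> (forall x : 'rV[R]_n, (forall i, 0 < x 0 i) -> G k x = Q x) ->
  exists H : 'rV[R]_n -> R, (forall r, 0 <= r <= 1 -> wiener r (M * r ^+ k) H) /\
    forall x : 'rV[R]_n, (forall i, 0 < x 0 i) -> in_box 1 x -> G k x = H x.
Proof.
move=> Qw GQ; have [H [Hw HM HQ Ht]] := wiener_homogeneous ltr01 Qw.
exists (H k); split=> [r r01|x x0 x1]; first by have := Hw k r r01; rewrite divr1.
have ray : ray_series (H ^~ x) (fun t => Q (t *: x)).
  exists 1 => //; exists M; split=> [|t /andP[t0 t1]].
    by apply: abs_sums_le_mono (HM x x1) => j; rewrite expr1n mulr1.
  have t1' : `|t| <= 1 by rewrite ger0_norm.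
  by apply: eq_has_sum (HQ _ (in_boxZ t1' x1)) => j; rewrite Ht// mulrC.
have ray' : ray_series (fun j => if j == k then G k x else 0)
    (fun t => t ^+ k * G k x).
  exists 1 => //; exists `|G k x|; split=> [|t _].
    have := @abs_sums_le_finite _ _ (fun j => (if j == k then G k x else 0) * 1 ^+ j)
      [:: k] isT.
    rewrite big_seq1 eqxx expr1n mulr1; apply=> j.
    by rewrite inE => /negbTE ->; rewrite mul0r.
  have := @has_sum_finite _ _ (fun j => (if j == k then G k x else 0) * t ^+ j)
    [:: k] isT.
  rewrite big_seq1 eqxx mulrC; apply=> j.
  by rewrite inE => /negbTE ->; rewrite mul0r.
have := ray_series_unique ray ray' ltr01.
move=> /(_ _)/(congr1 (fun c => c k)) -> => [|t /andP[t0 _]]; first by rewrite eqxx.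
rewrite -GQ => [|i]; last by rewrite mxE mulr_gt0.
by rewrite ray_coefs_homogeneous// => i; exact: ltW.
Qed.

(** On the box found by Baire's theorem, interpolation bounds the norm of the
    polynomial [G k] by a geometric sequence in [k].  For small [r] the factor
    [r ^+ k] makes the sum of the homogeneous parts converge.  The sum agrees with
    [h] on an initial piece of each ray, whose length depends on the ray. *)
Lemma corner_power_series : exists (r M : R) (Phi : 'rV[R]_n -> R),
  [/\ 0 < r <= 2^-1, wiener r M Phi &
   forall x : 'rV[R]_n, (forall i, 0 < x 0 i) -> in_box r x ->
     exists2 e, 0 < e & forall t, 0 < t <= e -> h (t *: x) = Phi (t *: x)].
Proof.
have [N [b [d [d0 b0 bd GN]]]] := ray_coefs_uniform_bound.
pose C := (32 / d) ^+ n * N%:R.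
have C0 : 0 <= C by rewrite mulr_ge0// exprn_ge0// divr_ge0// ltW.
have exH k : exists H : 'rV[R]_n -> R,
    (forall r, 0 <= r <= 1 -> wiener r (N%:R * C ^+ k * r ^+ k) H) /\
    forall x : 'rV[R]_n, (forall i, 0 < x 0 i) -> in_box 1 x -> G k x = H x.
  have [|x xb|Q [_ Qw GQ]] := @box_interpolation R n k b d (N%:R ^+ k.+1) (G k) d0 b0 bd.
  - exact: ray_coefs_separately_poly.
  - apply: GN => i; have [j ->] := xb i; rewrite /box_node lerDl lerD2l.
    apply/andP; split; first by rewrite mulr_ge0 ?divr_ge0// ltW.
    apply: ler_piMr; first exact: ltW.
    by rewrite ler_pdivrMr// mul1r ler_nat ltnW.
  apply: homogeneous_part_of_ray_coefs GQ; apply: wiener_norm_le Qw.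
  rewrite exprS mulrCA ler_wpM2l// [C ^+ k]exprMn ler_wpM2r ?exprn_ge0//.
  rewrite exprAC lerXn2r ?nnegrE ?mulr_ge0 ?exprn_ge0 ?divr_ge0 ?(ltW d0)//.
  rewrite (_ : 32 / d = 2 * (16 / d)); last by rewrite mulrA -natrM.
  rewrite [leRHS]exprMn ler_wpM2r ?exprn_ge0 ?divr_ge0 ?(ltW d0)// -natrX ler_nat.
  exact: ltn_expl.
have [H HH] := choice exH.
pose r := (2 * (C + 1))^-1.
have C1 : 0 < C + 1 by rewrite ltr_wpDl.
have r0 : 0 < r by rewrite invr_gt0 mulr_gt0.
have r2 : r <= 2^-1 by rewrite lef_pV2 ?posrE ?mulr_gt0// ler_peMr// lerDr.
have r1 : r <= 1 by apply: le_trans r2 _; rewrite invf_le1// ler1n.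
have Hw k : wiener r (N%:R * 2^-1 ^+ k) (H k).
  have [/(_ r) + _] := HH k; rewrite (ltW r0) r1 => /(_ isT).
  apply: wiener_norm_le; rewrite -mulrA ler_wpM2l// -exprMn lerXn2r ?nnegrE//.
    by rewrite mulr_ge0// ltW.
  by rewrite /r invfM mulrCA ler_piMr// ler_pdivrMr// mul1r lerDl.
have geo := abs_sums_le_geometric (ler0n R N).
have HN x : in_box r x -> abs_sums_le (H ^~ x) (2 * N%:R).
  move=> hx; apply: abs_sums_le_mono geo => k.
  exact: le_trans (wiener_le (Hw k) hx) (ler_norm _).
have exPhi (x : 'rV[R]_n) : exists l, in_box r x -> has_sum (H ^~ x) l.
  have [hx|hx] := pselect (in_box r x); last by exists 0.
  by have [l hl] := abs_sums_le_has_sum (HN x hx); exists l.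
have [Phi HPhi] := choice exPhi.
exists r, (2 * N%:R), Phi; split; first by rewrite r0.
  exact: wiener_series r0 Hw geo HPhi.
move=> x x0 xr.
have [e e0 [M [_ he]]] := G_ray (fun i => ltW (x0 i)).
exists (Num.min e 1) => [|t /andP[t0]]; first by rewrite lt_min e0/=.
rewrite le_min => /andP[te t1].
have t1' : `|t| <= 1 by rewrite gtr0_norm.
have txr := in_boxZ t1' xr.
have := he t; rewrite (ltW t0) te => /(_ isT) /has_sum_unique; apply.
apply: eq_has_sum (HPhi _ txr) => k; have [_ <-] := HH k.
- by rewrite ray_coefs_homogeneous// => [|i]; [rewrite mulrC|exact: ltW].
- by move=> i; rewrite mxE mulr_gt0.
- exact: in_box_le txr.
Qed.

Hypothesis h_along : forall x : 'rV[R]_n,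
  (forall i, 0 < x 0 i < 1) -> analytic_along h x.

(** Continuation along each ray from its initial piece reaches all points of a cube
    that does not depend on the ray. *)
Theorem corner_expansion : exists (r M : R) (Phi : 'rV[R]_n -> R),
  [/\ 0 < r <= 1, wiener r M Phi &
   forall x : 'rV[R]_n, (forall i, 0 < x 0 i < r) -> h x = Phi x].
Proof.
have [r [M [Phi [/andP[r0 r2] Pw PE]]]] := corner_power_series.
have r1 : r <= 1 by apply: le_trans r2 _; rewrite invf_le1// ler1n.
exists r, M, Phi; split=> //; first by rewrite r0.
move=> x xr.
have [|i|e e0 he] := PE x.
- by move=> i; have /andP[] := xr i.
- by have /andP[x0 /ltW] := xr i; rewrite gtr0_norm.
pose t1 := Num.min e 1 / 2.
have t1_gt0 : 0 < t1 by rewrite divr_gt0// lt_min e0/=.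
have t1_lt : t1 < e.
  apply: (@lt_le_trans _ _ (Num.min e 1)); last by rewrite ge_min lexx.
  by rewrite ltr_pdivrMr// ltr_pMr ?ltr1n// lt_min e0/=.
have t1_lt1 : t1 < 1.
  apply: (@lt_le_trans _ _ (Num.min e 1)); last by rewrite ge_min lexx orbT.
  by rewrite ltr_pdivrMr// ltr_pMr ?ltr1n// lt_min e0/=.
have seg t : t1 *: x + t *: (x - t1 *: x) = (t1 + t * (1 - t1)) *: x.
  by rewrite -{2}[x]scale1r -scalerBl scalerA -scalerDl.
have seg01 t : 0 <= t <= 1 -> 0 < t1 + t * (1 - t1) <= 1 by nra.
have segr t : 0 <= t <= 1 -> forall i, 0 < ((t1 + t * (1 - t1)) *: x) 0 i < r.
  move=> /seg01/andP[s0 s1] i; rewrite mxE; have /andP[x0 xr'] := xr i.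
  by rewrite mulr_gt0//= (le_lt_trans _ xr')// ler_piMl// ltW.
apply: (segment_identity (y := t1 *: x) (e := e - t1)).
- move=> t t01; rewrite seg; apply: h_along => i.
  by have /andP[-> xr'] := segr t t01 i; rewrite (lt_le_trans xr').
- move=> t t01; rewrite seg; apply: wiener_along Pw _ => i.
  by have /andP[x0 xr'] := segr t t01 i; rewrite gtr0_norm.
- by rewrite subr_gt0.
- move=> t /andP[t0 te]; rewrite seg; apply: he; apply/andP; split; nra.
Qed.

End Corner.

Theorem corner_analytic (R : realType) (n : nat) (h : 'rV[R]_n -> R) :
  (forall a b : 'rV[R]_n, (forall i, 0 <= a 0 i) -> (forall i, 0 <= b 0 i) ->
     exists e : nat -> nat -> R, forall u, 0 <= u ->
       ray_series (fun k => \sum_(j < k.+1) e k j * u ^+ j)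
         (fun t => h (t *: (a + u *: b)))) ->
  (forall x : 'rV[R]_n, (forall i, 0 < x 0 i < 1) -> analytic_along h x) ->
  exists (r M : R) (Phi : 'rV[R]_n -> R),
  [/\ 0 < r <= 1, wiener r M Phi &
   forall x : 'rV[R]_n, (forall i, 0 < x 0 i < r) -> h x = Phi x].
Proof.
move=> ray_poly h_along; have [G hG] := ray_coefs ray_poly.
by apply: (corner_expansion _ hG).
Qed.

(** * Even power series in two variables *)

Section Even.
Context {R : realType}.

Lemma monom2 (u : 'rV[R]_2) al :
  monom u al = u 0 ord0 ^+ al ord0 * u 0 ord_max ^+ al ord_max.
Proof.
rewrite /mpoly.mmap1 big_ord_recl big_ord_recl big_ord0 mulr1.
by have -> : lift ord0 ord0 = ord_max :> 'I_2 by apply/val_inj.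
Qed.

Lemma mdeg2 (al : mpoly.multinom 2) :
  mpoly.mdeg al = (al ord0 + al ord_max)%N.
Proof.
rewrite mpoly.mdegE big_ord_recl big_ord_recl big_ord0 addn0.
by have -> : lift ord0 ord0 = ord_max :> 'I_2 by apply/val_inj.
Qed.

(** Averaging over the four sign changes leaves only the even exponents, so the
    squares can be taken as new variables. *)
Lemma even_has_sum (c : mpoly.multinom 2 -> R) (psi : R -> R -> R) s t :
  (forall e e' : bool,
     has_sum (fun al : mpoly.multinom 2 =>
       c al * (((-1) ^+ e * s) ^+ al ord0 * ((-1) ^+ e' * t) ^+ al ord_max))
     (psi (s ^+ 2) (t ^+ 2))) ->
  has_sum (fun al : mpoly.multinom 2 =>
    if ~~ odd (al ord0) && ~~ odd (al ord_max)
    then c al * ((s ^+ 2) ^+ (al ord0)./2 * (t ^+ 2) ^+ (al ord_max)./2) else 0)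
  (psi (s ^+ 2) (t ^+ 2)).
Proof.
move=> h.
have := has_sumZ 4^-1 (has_sumD (has_sumD (h false false) (h false true))
  (has_sumD (h true false) (h true true))).
rewrite (_ : 4^-1 * _ = psi (s ^+ 2) (t ^+ 2)); last by field.
apply: eq_has_sum => al; rewrite !expr0 !expr1 !mul1r !mulN1r.
have neg x m : (- x) ^+ m = if odd m then - x ^+ m else x ^+ m :> R.
  by rewrite exprNn -signr_odd; case: odd; rewrite ?expr1 ?mulN1r ?mul1r.
rewrite !neg.
have half x m : ~~ odd m -> (x ^+ 2) ^+ m./2 = x ^+ m :> R.
  by move=> em; rewrite -exprM mul2n even_halfK.
have [h0|h0] := boolP (odd (al ord0)); have [h1|h1] := boolP (odd (al ord_max));
  rewrite /= ?half//; by field.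
Qed.

(** If [psi (s ^+ 2) (t ^+ 2)] is a power series in [s] and [t], then [psi] is a power
    series on a quadrant.  Its part of degree [k] on the ray of slope [u] is a
    polynomial in [u]. *)
Lemma even_wiener_ray_series rho M (g : 'rV[R]_2 -> R) (psi : R -> R -> R) :
  0 < rho -> wiener rho M g ->
  (forall u, in_box rho u -> g u = psi (u 0 ord0 ^+ 2) (u 0 ord_max ^+ 2)) ->
  exists e : nat -> nat -> R, forall u, 0 <= u ->
    ray_series (fun k => \sum_(j < k.+1) e k j * u ^+ j) (fun t => psi t (t * u)).
Proof.
move=> r0 [c [cM cg]] gpsi.
pose p (al : mpoly.multinom 2) := ((al ord0)./2, (al ord_max)./2).
pose ev (al : mpoly.multinom 2) := ~~ odd (al ord0) && ~~ odd (al ord_max).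
pose d al := if ev al then c al else 0.
pose term (x : R * R) (q : nat * nat) := x.1 ^+ q.1 * x.2 ^+ q.2.
pose small (x : R * R) := (0 <= x.1 <= rho ^+ 2) && (0 <= x.2 <= rho ^+ 2).
have rr0 : 0 < rho ^+ 2 by rewrite exprn_gt0.
have dM x : small x -> abs_sums_le (fun al => d al * term x (p al)) M.
  move=> /andP[/andP[x0 x1] /andP[y0 y1]]; apply: abs_sums_le_mono cM => al.
  rewrite /d /ev; case: ifP => [/andP[e0 e1]|_]; last by rewrite mul0r normr0.
  rewrite !normrM ler_wpM2l// /term /p /= mdeg2 exprD !normrM !normrX.
  rewrite (gtr0_norm r0) (ger0_norm x0) (ger0_norm y0).
  have E m : ~~ odd m -> rho ^+ m = (rho ^+ 2) ^+ m./2.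
    by move=> em; rewrite -exprM mul2n even_halfK.
  rewrite (E _ e0) (E _ e1); apply: ler_pM; rewrite ?exprn_ge0// lerXn2r ?nnegrE ?(ltW rr0)//.
have dsum x : small x -> has_sum (fun al => d al * term x (p al)) (psi x.1 x.2).
  move=> /andP[/andP[x0 x1] /andP[y0 y1]].
  have := @even_has_sum c psi (Num.sqrt x.1) (Num.sqrt x.2).
  rewrite !sqr_sqrtr// => /(_ _)/eq_has_sum; apply=> [al|e e'].
    by rewrite /d /ev; case: ifP => // _; rewrite mul0r.
  pose u : 'rV[R]_2 := \row_i (if i == ord0 then (-1) ^+ e * Num.sqrt x.1
    else (-1) ^+ e' * Num.sqrt x.2).
  have sq y : 0 <= y <= rho ^+ 2 -> `|Num.sqrt y| <= rho.
    move=> /andP[y00 yr]; rewrite ger0_norm ?sqrtr_ge0//.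
    by rewrite -(ger0_norm (ltW r0)) -sqrtr_sqr ler_sqrt// ltW.
  have ur : in_box rho u.
    by move=> i; rewrite mxE; case: ifP => _; rewrite normrM normrX normrN1 expr1n mul1r sq// ?x0 ?y0.
  have := cg u ur; rewrite gpsi// !mxE /= !exprMn !sqr_sqrtr// !sqrr_sign !mul1r.
  by apply: eq_has_sum => al; rewrite monom2 !mxE.
have rsmall : small (rho ^+ 2, rho ^+ 2) by rewrite /small /= lexx ltW.
have ex q : exists l, has_sum
    (fun al => if p al == q then d al * term (rho ^+ 2, rho ^+ 2) (p al) else 0) l.
  apply: (@abs_sums_le_has_sum _ _ _ M); apply: abs_sums_le_mono (dM _ rsmall) => al.
  by case: ifP => _ //; rewrite normr0.
have [l hl] := choice ex.
pose e' q := l q / term (rho ^+ 2, rho ^+ 2) q.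
have term0 q : term (rho ^+ 2, rho ^+ 2) q != 0.
  by rewrite mulf_neq0// expf_neq0// gt_eqF.
have fib x q : small x ->
    has_sum (fun al => if p al == q then d al * term x (p al) else 0) (e' q * term x q).
  move=> xs; have := has_sumZ (term x q / term (rho ^+ 2, rho ^+ 2) q) (hl q).
  rewrite (_ : _ * l q = e' q * term x q); last by rewrite /e'; field.
  apply: eq_has_sum => al; case: eqP => [->|_]; last by rewrite mulr0.
  by field.
exists (fun k j => e' ((k - j)%N, j)) => u u0.
have u1 : 0 < 1 + u by rewrite ltr_wpDr.
have ray t : 0 <= t <= rho ^+ 2 / (1 + u) ->
    abs_sums_le (fun k => (\sum_(j < k.+1) e' ((k - j)%N, nat_of_ord j) * u ^+ j) * t ^+ k) M /\
    has_sum (fun k => (\sum_(j < k.+1) e' ((k - j)%N, nat_of_ord j) * u ^+ j) * t ^+ k) (psi t (t * u)).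
  move=> /andP[t0]; rewrite ler_pdivlMr// mulrDr mulr1 => tr.
  have tu0 : 0 <= t * u by rewrite mulr_ge0.
  have ts : small (t, t * u).
    by rewrite /small /= t0 tu0 (le_trans _ tr) ?lerDl// (le_trans _ tr) ?lerDr.
  have [eM eS] := has_sum_fibers (dM _ ts) (fun q => fib _ q ts).
  have fib' k : has_sum
      (fun q : nat * nat => if (q.1 + q.2)%N == k then e' q * term (t, t * u) q else 0)
      ((\sum_(j < k.+1) e' ((k - j)%N, nat_of_ord j) * u ^+ j) * t ^+ k).
    have := @has_sum_finite _ _ (fun q : nat * nat =>
      if (q.1 + q.2)%N == k then e' q * term (t, t * u) q else 0)
      [seq ((k - j)%N, j) | j <- iota 0 k.+1].
    rewrite big_map map_inj_uniq => [|i j [_ ->]//]; rewrite iota_uniq.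
    rewrite (_ : \sum_(_ <- _) _ = (\sum_(j < k.+1) e' ((k - j)%N, nat_of_ord j) * u ^+ j) * t ^+ k).
      apply=> // -[i j]; case: eqP => // <- /negP[]; apply/mapP.
      by exists j; [rewrite mem_iota ltnS leq_addl|rewrite /fst /snd addnK].
    have -> : iota 0 k.+1 = index_iota 0 k.+1 by rewrite /index_iota subn0.
    rewrite big_mkord mulr_suml.
    apply: eq_bigr => -[j /= jk] _; have jk' : (j <= k)%N by [].
    rewrite subnK// eqxx -mulrA; congr (_ * _).
    by rewrite /term /= exprMn mulrA -exprD subnK// mulrC.
  have [eM' eS'] := has_sum_fibers eM fib'.
  by split=> //; apply: eS'; apply: eS; exact: (dsum _ ts).
exists (rho ^+ 2 / (1 + u)); first by rewrite divr_gt0.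
exists M; split=> [|t /ray[]//].
by apply: (ray _ _).1; rewrite lexx andbT divr_ge0 ?ltW.
Qed.

End Even.

(** * Polynomial maps and plots *)

Section PolynomialMaps.
Context {R : realType}.

(** Without its constant term a polynomial has a norm that tends to 0 with the
    radius, as substitution into a power series requires. *)
Lemma meval_wiener m (p : mpoly.mpoly m R) : exists2 K, 0 <= K &
  forall rho, 0 < rho <= 1 -> wiener rho (K * rho) (fun u : 'rV[R]_m =>
    mpoly.meval (fun j => u 0 j) p - mpoly.meval (fun j => (0 : 'rV[R]_m) 0 j) p).
Proof.
exists (\sum_(al <- mpoly.msupp p) `|mpoly.mcoeff al p|); first exact: sumr_ge0.
move=> rho /andP[r0 r1]; rewrite mulr_suml.
apply: (eq_wiener (g := fun u => \sum_(al <- mpoly.msupp p)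
    mpoly.mcoeff al p * (monom u al - monom (0 : 'rV[R]_m) al))).
  move=> u _; rewrite !mpoly.mevalE -sumrB; apply: eq_bigr => al _.
  by rewrite mulrBr.
apply: wiener_sum => // al; apply: wienerZ.
have [->|al0] := eqVneq al mpoly.mnm0.
  have := wiener_cst m 0 r0; rewrite normr0 => /(wiener_norm_le (ltW r0)).
  by apply: eq_wiener => u _; rewrite !mpoly.mmap11 subrr.
have d1 : (0 < mpoly.mdeg al)%N by rewrite lt0n mpoly.mdeg_eq0.
have mon0 : monom (0 : 'rV[R]_m) al = 0.
  by rewrite -[0 : 'rV[R]_m](scale0r 0) monom_scale expr0n eqn0Ngt d1 mul0r.
apply: (wiener_norm_le (M := rho ^+ mpoly.mdeg al)).
  by rewrite -(prednK d1) exprS ler_piMr ?(ltW r0)// exprn_ile1// ltW.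
by apply: eq_wiener (wiener_monom al r0) => u _; rewrite mon0 subr0.
Qed.

Lemma analytic_comp_poly m n (F : 'rV[R]_n -> R) (p : poly_map R m n) :
  analytic_at F (poly_map_eval p 0) ->
  analytic_at (fun u => F (poly_map_eval p u)) 0.
Proof.
move=> /analytic_wiener[r r0 [M hF]].
have /choice[K HK] : forall i, exists K, 0 <= K /\ forall rho, 0 < rho <= 1 ->
    wiener rho (K * rho) (fun u : 'rV[R]_m =>
      (poly_map_eval p u - poly_map_eval p 0) 0 i).
  move=> i; have [K K0 hK] := meval_wiener (p i); exists K; split=> // rho /hK.
  by apply: eq_wiener => u _; rewrite !mxE.
have [rho rho01 Kr] : exists2 rho, 0 < rho <= 1 & forall i, K i * rho <= r.
  exists (\big[Num.min/1]_i (r / (K i + 1))) => [|i].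
    apply/andP; split; last exact: bigmin_le_id.
    by apply: lt_bigmin => // i _; rewrite divr_gt0// ltr_wpDl// (HK i).1.
  have K1 : 0 < K i + 1 by rewrite ltr_wpDl// (HK i).1.
  apply: (@le_trans _ _ (K i * (r / (K i + 1)))).
    by rewrite ler_wpM2l ?(HK i).1//; apply: bigmin_le_cond.
  by rewrite mulrCA ler_piMr ?(ltW r0)// ler_pdivrMr// mul1r lerDl.
have /andP[rho0 _] := rho01.
apply: (wiener_analytic (rho := rho) (M := M)) => //.
apply: eq_wiener (wiener_comp (q := fun u => poly_map_eval p u - poly_map_eval p 0)
  rho0 hF (fun i => (HK i).2 rho rho01) Kr) => u _.
by rewrite /= addrC subrK add0r.
Qed.

Lemma quadratic_poly_map n (y v a b : 'rV[R]_n) : exists p : poly_map R 2 n,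
  (forall i, (mpoly.msize (p i) <= 3)%N) /\
  forall u, poly_map_eval p u =
    y + u 0 ord0 *: v + u 0 ord0 ^+ 2 *: a + u 0 ord_max ^+ 2 *: b.
Proof.
pose X (i : 'I_2) := mpoly.mnm1 i.
pose XX (i : 'I_2) := mpoly.mnm_add (X i) (X i).
exists (fun i => mpoly.mpolyC 2 (y 0 i) + v 0 i *: mpoly.mpolyX R (X ord0)
  + a 0 i *: mpoly.mpolyX R (XX ord0) + b 0 i *: mpoly.mpolyX R (XX ord_max)).
split=> [i|u].
  have add3 (q q' : mpoly.mpoly 2 R) : (mpoly.msize q <= 3)%N ->
      (mpoly.msize q' <= 3)%N -> (mpoly.msize (q + q') <= 3)%N.
    by move=> hq hq'; apply: leq_trans (mpoly.msizeD_le _ _) _; rewrite geq_max hq.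
  have scale3 (c : R) (al : mpoly.multinom 2) : (mpoly.mdeg al <= 2)%N ->
      (mpoly.msize (c *: mpoly.mpolyX R al) <= 3)%N.
    by move=> h; apply: leq_trans (mpoly.msizeZ_le _ _) _; rewrite mpoly.msizeX.
  apply: (add3); [apply: (add3); [apply: (add3)|]|].
  - by rewrite mpoly.msizeC; case: eqP.
  - by apply: scale3; rewrite mpoly.mdeg1.
  - by apply: scale3; rewrite mpoly.mdegD !mpoly.mdeg1.
  - by apply: scale3; rewrite mpoly.mdegD !mpoly.mdeg1.
have X1 k : mpoly.meval (fun j => u 0 j) (mpoly.mpolyX R (X k)) = u 0 k.
  exact: mpoly.mevalXU.
have X2 k : mpoly.meval (fun j => u 0 j) (mpoly.mpolyX R (XX k)) = u 0 k ^+ 2.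
  rewrite mpoly.mevalX -[LHS]/(monom u (XX k)) monomD.
  by rewrite /X !mpoly.mmap1U expr2.
apply/matrixP => j i; rewrite ord1 !mxE !mpoly.mevalD !mpoly.mevalZ mpoly.mevalC.
by rewrite !X1 !X2; congr (_ + _ + _ + _); rewrite mulrC.
Qed.

End PolynomialMaps.

(** * Functions analytic along quadratic plots *)

Section Plots.
Context {R : realType} {n : nat} (X : set 'rV[R]_n) (f : X -> R).

(** A total function can be evaluated along lines and plots without membership
    proofs. *)
Definition extend_by0 (x : 'rV[R]_n) : R := if insub x is Some u then f u else 0.

Lemma extend_by0_val (x : X) : extend_by0 (val x) = f x.
Proof. by rewrite /extend_by0 valK. Qed.

Hypothesis f_plot : plot_analytic 2 2 X f.

Lemma quadratic_plot_wiener (y v a b : 'rV[R]_n) :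
  (\forall u \near (0 : 'rV[R]_2),
     X (y + (u : 'rV[R]_2) 0 ord0 *: v + u 0 ord0 ^+ 2 *: a +
        u 0 ord_max ^+ 2 *: b)) ->
  exists2 rho, 0 < rho & exists (M : R) (g : 'rV[R]_2 -> R), wiener rho M g /\
    forall u, in_box rho u -> g u = extend_by0
      (y + u 0 ord0 *: v + u 0 ord0 ^+ 2 *: a + u 0 ord_max ^+ 2 *: b).
Proof.
have [p [p3 pE]] := quadratic_poly_map y v a b.
move=> /near_boxP[e e0 Xu].
have pplot : plot 2 X p.
  by split=> //; apply/near_boxP; exists e => // u /Xu; rewrite pE.
have [g /analytic_wiener[r r0 [M hg]] /near_boxP[e' e'0 gE]] := f_plot pplot.
pose rho := Num.min r (Num.min e e').
have rho0 : 0 < rho by rewrite lt_min r0 lt_min e0.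
exists rho => //; exists M, g; split=> [|u ur].
  have : wiener rho M (fun u => g (0 + u)).
    by apply: wiener_radius_le hg; rewrite (ltW rho0) ge_min lexx.
  by apply: eq_wiener => u _; rewrite add0r.
have ue : in_box e (u - 0) by rewrite subr0; apply: in_box_le ur; rewrite !ge_min lexx !orbT.
have ue' : in_box e' (u - 0) by rewrite subr0; apply: in_box_le ur; rewrite !ge_min lexx !orbT.
have Xpu := Xu _ ue; rewrite -pE in Xpu *.
have [x xE] : exists x : X, val x = poly_map_eval p u by exists (SigSub (mem_set Xpu)).
by rewrite -xE extend_by0_val (gE _ ue' x xE).
Qed.

Lemma interior_box (y : 'rV[R]_n) : X° y ->
  exists2 e, 0 < e & forall x, in_box e (x - y) -> X x.
Proof. by move=> /near_boxP. Qed.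

Lemma extend_along (y : 'rV[R]_n) : X° y -> analytic_along extend_by0 y.
Proof.
move=> /interior_box[e e0 Xe] v.
pose S := \sum_i `|v 0 i| + 1.
have S0 : 0 < S by rewrite ltr_wpDl// sumr_ge0.
have [|rho r0 [M [g [hg gE]]]] := @quadratic_plot_wiener y v 0 0.
  apply/near_boxP; exists (e / S); first by rewrite divr_gt0.
  move=> u; rewrite subr0 => ue; apply: Xe => i.
  rewrite !scaler0 !addr0 addrC addKr mxE normrM.
  apply: le_trans (ler_pM _ _ (ue ord0) (_ : _ <= S)) _ => //.
    by rewrite /S (bigD1 i)//= -addrA lerDl addr_ge0// sumr_ge0.
  by rewrite divfK// gt_eqF.
have [c hc] := wiener_line_series (delta_mx 0 ord0) r0 hg.
exists c; move: hc => [s s0 [N [cN hc]]].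
exists (Num.min s rho); first by rewrite lt_min s0.
exists N; split=> [|t].
  apply: abs_sums_le_mono cN => k; rewrite !normrM ler_wpM2l// !normrX lerXn2r//.
  by rewrite !gtr0_norm ?lt_min ?s0// ge_min lexx.
rewrite le_min => /andP[ts tr].
have := hc t ts; rewrite gE => [|i].
  by rewrite !scaler0 !addr0 !mxE eqxx mulr1.
rewrite !mxE eqxx /=; case: eqP => _; first by rewrite mulr1.
by rewrite mulr0 normr0 ltW.
Qed.

(** Quadratic plots reach into corners: [(s, t) |-> z + (s^2 a + t^2 b) A] maps a
    neighborhood of the origin into [X] although [z] may lie on the boundary. *)
Lemma corner_ray_poly (z : 'rV[R]_n) (A : 'M[R]_n) :
  (forall x : 'rV[R]_n, (forall i, 0 <= x 0 i <= 1) -> X (z + x *m A)) ->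
  forall a b : 'rV[R]_n, (forall i, 0 <= a 0 i) -> (forall i, 0 <= b 0 i) ->
    exists e : nat -> nat -> R, forall u, 0 <= u ->
      ray_series (fun k => \sum_(j < k.+1) e k j * u ^+ j)
        (fun t => extend_by0 (z + (t *: (a + u *: b)) *m A)).
Proof.
move=> XA a b a0 b0.
pose S := \sum_i (a 0 i + b 0 i) + 1.
have S0 : 0 < S by rewrite ltr_wpDl// sumr_ge0// => i _; rewrite addr_ge0.
have [|rho r0 [M [g [hg gE]]]] := @quadratic_plot_wiener z 0 (a *m A) (b *m A).
  pose e := Num.min 1 S^-1.
  have e0 : 0 < e by rewrite lt_min ltr01 invr_gt0.
  apply/near_boxP; exists e => // u; rewrite subr0 => ue.
  rewrite scaler0 addr0 -addrA !scalemxAl -mulmxDl; apply: XA => i.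
  have pos c d : 0 <= d -> 0 <= c ^+ 2 * d :> R by move=> d0; rewrite mulr_ge0// sqr_ge0.
  rewrite !mxE addr_ge0 ?pos//=.
  have sq k : u 0 k ^+ 2 <= S^-1.
    have := ue k; rewrite le_min => /andP[u1 uS].
    rewrite -real_normK ?num_real// expr2.
    by apply: le_trans (ler_piMl _ u1) uS.
  apply: (@le_trans _ _ (S^-1 * (a 0 i + b 0 i))).
    by rewrite mulrDr lerD// ler_wpM2r.
  rewrite ler_pdivrMl// mulr1 /S (bigD1 i)//= -addrA lerDl addr_ge0//.
  by apply: sumr_ge0 => j _; rewrite addr_ge0.
have [|e he] := even_wiener_ray_series
  (psi := fun s t => extend_by0 (z + (s *: a + t *: b) *m A)) r0 hg.
  by move=> u /gE ->; rewrite scaler0 addr0 -addrA !scalemxAl -mulmxDl.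
exists e => u u0; apply: eq_ray_series (he u u0) => t.
by rewrite scalerDr scalerA.
Qed.

End Plots.

(** * Corners *)

(** A nondegenerate parallelepiped in [X] with vertex [z].  Interior points and
    points on the boundary are treated alike through such corners. *)
Definition corner (R : realType) (n : nat) (X : set 'rV[R]_n) (z : 'rV[R]_n)
    (A : 'M[R]_n) :=
  A \in unitmx /\ forall x : 'rV[R]_n, (forall i, 0 <= x 0 i <= 1) -> X (z + x *m A).

Section Geometry.
Context {R : realType} {n : nat}.
Implicit Types (X : set 'rV[R]_n) (z w x y : 'rV[R]_n) (A : 'M[R]_n).

Lemma ball_coordP z y (r : R) : 0 < r ->
  ball z r y <-> forall i, `|(y - z) 0 i| < r.
Proof.
move=> r0; split=> [zy i|zy].
  by have := zy.2 0 i; rewrite /ball/= !mxE distrC.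
by split=> // j i; have := zy i; rewrite /ball/= !mxE ord1 distrC.
Qed.

Lemma ball_segment z y x (r t : R) : 0 < r -> 0 <= t <= 1 ->
  ball z r y -> ball z r x -> ball z r (y + t *: (x - y)).
Proof.
move=> r0 /andP[t0 t1] /(ball_coordP _ _ r0) hy /(ball_coordP _ _ r0) hx.
apply/ball_coordP => // i.
have -> : (y + t *: (x - y) - z) 0 i = (1 - t) * (y - z) 0 i + t * (x - z) 0 i.
  by rewrite !mxE; ring.
have t1' : 0 <= 1 - t by rewrite subr_ge0.
have := hy i; have := hx i; set a := (y - z) 0 i; set b := (x - z) 0 i => br ar.
apply: le_lt_trans (ler_normD _ _) _; rewrite !normrM (ger0_norm t0) (ger0_norm t1').
have [->|tn0] := eqVneq t 0; first by rewrite subr0 mul1r mul0r addr0.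
rewrite (_ : r = (1 - t) * r + t * r); last by ring.
have t0' : 0 < t by rewrite lt0r tn0.
by apply: ler_ltD; [rewrite ler_wpM2l// ltW|rewrite ltr_pM2l].
Qed.

Lemma near_segment y v (P : set 'rV[R]_n) : (\forall x \near y, P x) ->
  exists2 e, 0 < e & forall t, 0 <= t < e -> P (y + t *: v).
Proof.
move=> /near_boxP[e e0 hP].
pose S := \sum_i `|v 0 i| + 1.
have S0 : 0 < S by rewrite ltr_wpDl// sumr_ge0.
exists (e / S) => [|t /andP[t0 te]]; first by rewrite divr_gt0.
apply: hP => i; rewrite addrC addKr mxE normrM (ger0_norm t0).
apply: (@le_trans _ _ (t * S)); last by rewrite -ler_pdivlMr// ltW.
by rewrite ler_wpM2l// /S (bigD1 i)//= -addrA lerDl addr_ge0// sumr_ge0.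
Qed.

Lemma near_affine_box z A x r (P : set 'rV[R]_n) : A \in unitmx ->
  (forall i, 0 < x 0 i < r) ->
  (forall x' : 'rV[R]_n, (forall i, 0 < x' 0 i < r) -> P (z + x' *m A)) ->
  \forall y \near (z + x *m A), P y.
Proof.
move=> uA xr hP; pose B := invmx A.
pose e i := Num.min (x 0 i) (r - x 0 i) / 2 / (\sum_j `|B j i| + 1).
have S0 i : 0 < \sum_j `|B j i| + 1 by rewrite ltr_wpDl// sumr_ge0.
have m0 i : 0 < Num.min (x 0 i) (r - x 0 i).
  by have /andP[a b] := xr i; rewrite lt_min a subr_gt0.
apply/near_boxP; exists (\big[Num.min/1]_i e i).
  by apply: lt_bigmin => // i _; rewrite !divr_gt0.
move=> y hy.
pose u := (y - (z + x *m A)) *m B.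
have -> : y = z + (x + u) *m A.
  by rewrite mulmxDl -mulmxA mulVmx// mulmx1 addrA addrC subrK.
apply: hP => i.
have : `|u 0 i| < Num.min (x 0 i) (r - x 0 i).
  rewrite mxE; apply: le_lt_trans (ler_norm_sum _ _ _) _.
  apply: (@le_lt_trans _ _ (\sum_j e i * `|B j i|)).
    apply: ler_sum => j _; rewrite normrM ler_wpM2r//.
    by apply: le_trans (hy j) _; apply: bigmin_le_cond.
  rewrite -mulr_sumr; apply: (@le_lt_trans _ _ (e i * (\sum_j `|B j i| + 1))).
    by rewrite ler_wpM2l ?lerDl// ltW// !divr_gt0.
  by rewrite divfK ?gt_eqF// ltr_pdivrMr// ltr_pMr// ltr1n.
rewrite lt_min !ltr_norml => /andP[/andP[a b] /andP[c d]].
by rewrite mxE; apply/andP; split; lra.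
Qed.

Lemma corner_interior X z A x : corner X z A -> (forall i, 0 < x 0 i < 1) ->
  X° (z + x *m A).
Proof.
move=> [uA XA] x01; apply: (near_affine_box uA x01) => x' x'01; apply: XA => i.
by have /andP[/ltW -> /ltW ->] := x'01 i.
Qed.

Lemma interior_corner X z : X° z -> exists A, corner X z A.
Proof.
move=> /interior_box[e e0 Xe]; exists e%:M; split.
  by rewrite -scalemx1 unitmxZ ?unitmx1// unitfE gt_eqF.
move=> x x01; apply: Xe => i; rewrite addrC addKr mul_mx_scalar mxE normrM.
have /andP[x0 x1] := x01 i.
by rewrite gtr0_norm// ger0_norm// ler_piMr// ltW.
Qed.

(** A vertex with positive weight at [z] can be replaced by [z]: the simplex
    spanned by [z] and the other vertices is nondegenerate, with vertex [z]. *)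
Lemma simplex_corner (S : set 'rV[R]_n) z : simplex S -> S z ->
  exists A, corner S z A.
Proof.
move=> [v vI ->] [w [w0 w1 zE]].
have [i0 wi0] : exists i0, 0 < w i0.
  apply: contrapT => /forallNP wn.
  have : \sum_i w i = 0.
    apply: big1 => i _; apply/eqP; rewrite eq_le w0 andbT leNgt.
    by apply/negP; exact: wn.
  by rewrite w1 => /eqP; rewrite oner_eq0.
pose y (x : 'rV[R]_n) (j : 'I_n.+1) := if unlift i0 j is Some i then n.+1%:R^-1 * x 0 i else 0.
pose s x := \sum_j y x j.
have yl x i : y x (lift i0 i) = n.+1%:R^-1 * x 0 i by rewrite /y liftK.
have y0 x : y x i0 = 0 by rewrite /y unlift_none.
pose A := n.+1%:R^-1 *: \matrix_i (v (lift i0 i) - z).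
have xA x : x *m A = \sum_j (y x j - s x * w j) *: v j.
  have -> : \sum_j (y x j - s x * w j) *: v j = \sum_j y x j *: v j - s x *: z.
    rewrite zE scaler_sumr -sumrB; apply: eq_bigr => j _.
    by rewrite scalerBl scalerA.
  rewrite /s !(bigD1_ord i0)//= y0 scale0r !add0r scaler_suml -sumrB.
  rewrite mulmx_sum_row; apply: eq_bigr => i _.
  by rewrite /A linearZ /= rowK !yl -scalerBr scalerA mulrC.
exists A; split.
  rewrite -row_free_unit; apply: inj_row_free => x x0.
  have c0 j : y x j - s x * w j = 0.
    apply: (vI (fun j => y x j - s x * w j)); last by rewrite -xA.
    by rewrite sumrB -mulr_sumr w1 mulr1 subrr.
  have sx : s x = 0.
    have /eqP := c0 i0; rewrite y0 sub0r oppr_eq0 mulf_eq0 (gt_eqF wi0) orbF.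
    by move=> /eqP.
  apply/matrixP => k i; rewrite ord1 mxE.
  have /eqP := c0 (lift i0 i); rewrite sx mul0r subr0 yl mulf_eq0 invr_eq0.
  by rewrite pnatr_eq0 /= => /eqP.
move=> x x01.
have y_ge0 j : 0 <= y x j.
  rewrite /y; case: unlift => // i.
  by rewrite mulr_ge0 ?invr_ge0//; have /andP[] := x01 i.
have s1 : s x <= 1.
  rewrite /s (bigD1_ord i0)//= y0 add0r.
  apply: (@le_trans _ _ (\sum_(i < n) n.+1%:R^-1)).
    apply: ler_sum => i _; rewrite yl ler_piMr ?invr_ge0//.
    by have /andP[] := x01 i.
  by rewrite sumr_const card_ord -[leLHS]mulr_natl ler_pdivrMr// mul1r ler_nat.
exists (fun j => w j + (y x j - s x * w j)); split.
- move=> j; have -> : w j + (y x j - s x * w j) = y x j + (1 - s x) * w j by ring.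
  by rewrite addr_ge0// mulr_ge0// subr_ge0.
- by rewrite big_split /= sumrB -mulr_sumr w1 mulr1 subrr addr0.
- by rewrite xA {1}zE -big_split /=; apply: eq_bigr => j _; rewrite -scalerDl.
Qed.

Lemma corner_near_interior X z A (P : set 'rV[R]_n) : corner X z A ->
  (\forall y \near z, P y) -> exists2 y, X° y & P y.
Proof.
move=> cA /(near_segment (const_mx 1 *m A))[e e0 he].
pose t := Num.min e 1 / 2.
have m0 : 0 < Num.min e 1 by rewrite lt_min e0/=.
have t0 : 0 < t by rewrite divr_gt0.
have tm : t < Num.min e 1 by rewrite ltr_pdivrMr// ltr_pMr// ltr1n.
move: tm; rewrite lt_min => /andP[te t1].
exists (z + t *: (const_mx 1 *m A)); last by apply: he; rewrite ltW.
rewrite scalemxAl; apply: (corner_interior cA) => i.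
by rewrite !mxE mulr1 t0.
Qed.

End Geometry.

(** * Extension across the boundary *)

Section Extension.
Context {R : realType} {n : nat}.
Implicit Types (X : set 'rV[R]_n) (z w x y : 'rV[R]_n) (A : 'M[R]_n).

Lemma wiener_along_at (F : 'rV[R]_n -> R) z y r M : 0 < r ->
  wiener r M (fun u => F (z + u)) -> ball z r y -> analytic_along F y.
Proof.
move=> r0 hF /(ball_coordP _ _ r0) zy v; have [c hc] := wiener_along hF zy v.
by exists c; apply: eq_line_series hc => s; rewrite addrA (addrC z) subrK.
Qed.

Lemma identity_from_open (g g' : 'rV[R]_n -> R) (D : set 'rV[R]_n) y x :
  (forall p, D p -> analytic_along g p) -> (forall p, D p -> analytic_along g' p) ->
  (forall t, 0 <= t <= 1 -> D (y + t *: (x - y))) ->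
  (\forall p \near y, g p = g' p) -> g x = g' x.
Proof.
move=> ag ag' Dseg /(near_segment (x - y))[e e0 he].
by apply: (segment_identity _ _ e0 he) => t /Dseg; [exact: ag|exact: ag'].
Qed.

Lemma ray_series_at0 c (phi : R -> R) : ray_series c phi -> phi 0 = c 0%N.
Proof.
move=> [r r0 [M [_ h]]]; have /h : 0 <= (0 : R) <= r by rewrite lexx ltW.
move=> /has_sum_unique; apply.
have := @has_sum_finite _ _ (fun k => c k * 0 ^+ k) [:: 0%N] isT.
rewrite big_seq1 expr0 mulr1; apply=> -[//|k] _.
by rewrite expr0n mulr0.
Qed.

Section PlotAnalytic.
Context {X : set 'rV[R]_n} (f : X -> R).
Hypothesis f_plot : plot_analytic 2 2 X f.
Local Notation g := (extend_by0 f).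

(** In the affine coordinates given by [A], the function [g] expands at the corner.
    The expansion agrees with [g] on open sets that accumulate at [z]. *)
Lemma corner_germ z A : corner X z A ->
  exists (r M : R) (F : 'rV[R]_n -> R),
  [/\ 0 < r, wiener r M (fun u => F (z + u)) &
   forall P : set 'rV[R]_n, (\forall y \near z, P y) ->
     exists2 y, P y & X° y /\ \forall x \near y, g x = F x].
Proof.
move=> cA; have [uA XA] := cA.
have [|s [M [Phi [/andP[s0 s1] Pw PE]]]] := corner_analytic
  (h := fun x => g (z + x *m A)) (corner_ray_poly f_plot XA).
  move=> x x01 v.
  have [c hc] := extend_along f_plot (corner_interior cA x01) (v *m A).
  by exists c; apply: eq_line_series hc => t; rewrite mulmxDl scalemxAl addrA.
have [|r r0 Fw] := wiener_comp_affine (b := 0) (invmx A) Pw.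
  by move=> i; rewrite mxE normr0.
exists r, M, (fun y => Phi ((y - z) *m invmx A)); split=> //.
  by apply: eq_wiener Fw => u _; rewrite add0r (addrC z) addrK.
move=> P /(near_segment (const_mx 1 *m A))[e e0 he].
pose t := Num.min e s / 2.
have m0 : 0 < Num.min e s by rewrite lt_min e0.
have t0 : 0 < t by rewrite divr_gt0.
have : t < Num.min e s by rewrite ltr_pdivrMr// ltr_pMr// ltr1n.
rewrite lt_min => /andP[te ts].
have x01 i : 0 < (t *: (const_mx 1 : 'rV[R]_n)) 0 i < s.
  by rewrite !mxE mulr1 t0.
exists (z + t *: (const_mx 1 *m A)); first by apply: he; rewrite ltW.
rewrite scalemxAl; split.
  apply: (corner_interior cA) => i; have /andP[-> h] := x01 i.
  exact: lt_le_trans h s1.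
apply: (near_affine_box uA x01) => x' x'01.
by rewrite PE// (addrC z) addrK mulmxK.
Qed.

(** Along a ray into a corner, [g] and [F] have one-sided expansions, which agree
    in the interior and hence also in their constant terms. *)
Lemma corner_value z A (F : 'rV[R]_n -> R) : corner X z A ->
  analytic_along F z -> (\forall x \near z, X° x -> g x = F x) -> g z = F z.
Proof.
move=> cA aF; pose a : 'rV[R]_n := const_mx 2^-1.
move=> /(near_segment (a *m A))[e e0 he].
have [_ XA] := cA.
have a0 i : 0 <= a 0 i by rewrite mxE invr_ge0.
have [k /(_ 0 (lexx _)) gk] := corner_ray_poly f_plot XA a0 a0.
have [c /line_ray_series Fc] := aF (a *m A).
have m0 : 0 < Num.min e 1 by rewrite lt_min e0/=.
have E : (fun k0 => \sum_(j < k0.+1) k k0 j * 0 ^+ j) = c.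
  apply: ray_series_unique gk Fc m0 _ => t /andP[t0].
  rewrite lt_min => /andP[te t1]; rewrite scale0r addr0 -scalemxAl.
  apply: he; first by rewrite (ltW t0).
  rewrite scalemxAl; apply: (corner_interior cA) => i.
  by rewrite !mxE mulr_gt0 ?invr_gt0//=; nra.
rewrite -E in Fc; have := etrans (ray_series_at0 gk) (esym (ray_series_at0 Fc)).
by rewrite !scale0r mul0mx !addr0.
Qed.

Hypothesis X_corner : forall z, X z -> exists A, corner X z A.

Definition germ_of z (rF : R * ('rV[R]_n -> R)) :=
  [/\ 0 < rF.1, exists M, wiener rF.1 M (fun u => rF.2 (z + u)) &
    forall y, X y -> ball z rF.1 y -> g y = rF.2 y].

(** Both germs agree with [g] on a small open subset of [X] near [w], and the
    intersection of the two balls is convex. *)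
Lemma germ_overlap z w (rF rF' : R * ('rV[R]_n -> R)) y : X w ->
  germ_of z rF -> germ_of w rF' -> ball z rF.1 w ->
  ball z rF.1 y -> ball w rF'.1 y -> rF.2 y = rF'.2 y.
Proof.
move=> Xw [r0 [M hF] Fg] [r'0 [M' hF'] Fg'] zw zy wy.
have [A cA] := X_corner Xw.
have [|y0 Xy0 [zy0 wy0]] := @corner_near_interior _ _ _ _ _
   (ball z rF.1 `&` ball w rF'.1) cA.
  apply: open_nbhs_nbhs; split; first by apply: openI; apply: ball_open.
  by split=> //; exact: ballxx.
apply: (@identity_from_open _ _ (ball z rF.1 `&` ball w rF'.1) y0).
- by move=> p [zp _]; exact: wiener_along_at hF zp.
- by move=> p [_ wp]; exact: wiener_along_at hF' wp.
- by move=> t t01; split; apply: ball_segment.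
have : \forall p \near y0, (X° `&` (ball z rF.1 `&` ball w rF'.1)) p.
  apply: open_nbhs_nbhs; split; last by [].
  by apply: openI; [exact: open_interior|apply: openI; apply: ball_open].
apply: filterS => p [/interior_subset Xp [zp wp]].
by rewrite -Fg// -Fg'.
Qed.

(** Unique continuation over the connected set [U `&` X°]. *)
Lemma connected_extension z r M (F : 'rV[R]_n -> R) (U : set 'rV[R]_n) : 0 < r ->
  wiener r M (fun u => F (z + u)) -> U `<=` ball z r -> connected (U `&` X°) ->
  (exists y, (U `&` X°) y /\ \forall x \near y, g x = F x) ->
  forall y, U y -> X° y -> g y = F y.
Proof.
move=> r0 hF Ur cU [y0 [Uy0 y0E]].
pose C : set 'rV[R]_n := [set y : 'rV[R]_n | \forall x \near y, g x = F x].
have openC : open C.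
  rewrite (_ : C = [set x | g x = F x]°)//; exact: open_interior.
have E : (U `&` X°) `&` C = U `&` X°.
  apply: cU; [by exists y0|by exists C|exists (closure C); first exact: closed_closure].
  apply/seteqP; split=> y [[Uy Xy]] => [Cy|cC]; split=> //; first exact: subset_closure.
  have : \forall p \near y, (X° `&` ball z r) p.
    apply: open_nbhs_nbhs; split; last by split=> //; exact: Ur.
    by apply: openI; [exact: open_interior|apply: ball_open].
  move=> /nbhs_ballP[e /= e0 eXr].
  have [y1 [Cy1 y1e]] := cC _ (nbhsx_ballx y e e0).
  apply/nbhs_ballP; exists e => //= p pe.
  apply: (@identity_from_open _ _ (ball y e) y1) => //.
  - by move=> q /eXr[Xq _]; exact: extend_along.
  - by move=> q /eXr[_ zq]; exact: wiener_along_at hF zq.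
  - by move=> t t01; apply: ball_segment.
move=> y Uy Xy; have : (U `&` X°) y by [].
by rewrite -E => -[_ /nbhs_singleton].
Qed.

Lemma interior_germ z : X° z -> exists rF, germ_of z rF.
Proof.
move=> Xz; have [A cA] := X_corner (interior_subset Xz).
have [r [M [F [r0 hF FE]]]] := corner_germ cA.
have /nbhs_ballP[e /= e0 Xe] : \forall x \near z, X° x.
  by apply: open_nbhs_nbhs; split; first exact: open_interior.
pose s := Num.min r e.
have s0 : 0 < s by rewrite lt_min r0.
have sr : s <= r by rewrite ge_min lexx.
have se : s <= e by rewrite ge_min lexx orbT.
have hF' : wiener s M (fun u => F (z + u)).
  by apply: wiener_radius_le hF; rewrite ltW.
exists (s, F); split=> //=; first by exists M.
move=> y _ zy.
have [y1 zy1 [_ y1E]] := FE (ball z s) (nbhsx_ballx z s s0).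
apply: (@identity_from_open _ _ (ball z s) y1) => //.
- by move=> p zp; apply: extend_along => //; apply: Xe; exact: le_ball zp.
- by move=> p zp; exact: wiener_along_at hF' zp.
- by move=> t t01; apply: ball_segment.
Qed.

(** Simplicity of [X] propagates the expansion from the corner to all interior points
    near [z]; the corners at the other boundary points near [z] transfer it to
    them. *)
Lemma boundary_germ z : simple_set X -> boundary X z -> X z -> exists rF, germ_of z rF.
Proof.
move=> sX bz Xz; have [A cA] := X_corner Xz.
have [r [M [F [r0 hF FE]]]] := corner_germ cA.
have [B [Bnbhs Bbasis Bconn]] := sX z bz.
have [U BU Ur] := Bbasis _ (nbhsx_ballx z r r0).
have [y1 Uy1 [Xy1 y1E]] := FE U (Bnbhs U BU).
have UE := connected_extension r0 hF Ur (Bconn U BU)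
  (ex_intro _ y1 (conj (conj Uy1 Xy1) y1E)).
have /nbhs_ballP[e /= e0 eU] := Bnbhs U BU.
pose s := Num.min r e.
have s0 : 0 < s by rewrite lt_min r0.
have sr : s <= r by rewrite ge_min lexx.
have se : s <= e by rewrite ge_min lexx orbT.
have hF' : wiener s M (fun u => F (z + u)).
  by apply: wiener_radius_le hF; rewrite ltW.
exists (s, F); split=> //=; first by exists M.
move=> y Xy zy; have [A' cA'] := X_corner Xy.
apply: (corner_value cA'); first exact: wiener_along_at hF' zy.
have : \forall x \near y, ball z s x.
  by apply: open_nbhs_nbhs; split=> //; exact: ball_open.
by apply: filterS => x /(le_ball se)/eU Ux Xx; exact: UE.
Qed.

End PlotAnalytic.

(** Two balls that meet after halving their radii are such that one of them
    contains the center of the other, where the germs can be compared. *)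
Lemma glue_germs (X : set 'rV[R]_n) (f : X -> R) : plot_analytic 2 2 X f ->
  (forall z, X z -> exists A, corner X z A) ->
  (forall z, X z -> exists rF, germ_of f z rF) ->
  analytic_restriction X f.
Proof.
move=> f_plot X_corner X_germ.
have /choice[G HG] : forall z, exists rF, X z -> germ_of f z rF.
  move=> z; have [Xz|nXz] := pselect (X z); last by exists (0, fun=> 0).
  by have [rF h] := X_germ z Xz; exists rF.
have r0 z : X z -> 0 < (G z).1 by move=> /HG[].
have overlap z w y : X z -> X w -> ball z ((G z).1 / 2) y ->
    ball w ((G w).1 / 2) y -> (G z).2 y = (G w).2 y.
  wlog wz : z w / (G w).1 <= (G z).1.
    move=> H Xz Xw zy wy; have [h|/ltW h] := leP (G w).1 (G z).1; first exact: H.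
    by apply/esym; exact: H.
  move=> Xz Xw zy wy.
  have half a : X a -> ball a ((G a).1 / 2) `<=` ball a (G a).1.
    by move=> Xa; apply: le_ball; rewrite ler_pdivrMr// ler_pMr ?r0// ler1n.
  apply: (germ_overlap X_corner Xw (HG z Xz) (HG w Xw)); try exact: half.
  rewrite [(G z).1]splitr; apply: ball_triangle zy _; apply: ball_sym.
  by apply: le_ball wy; rewrite ler_pM2r ?invr_gt0.
pose near_center y := [set z | X z /\ ball z ((G z).1 / 2) y].
pose F y := (G (xget y (near_center y))).2 y.
have FE z y : X z -> ball z ((G z).1 / 2) y -> F y = (G z).2 y.
  move=> Xz zy; rewrite /F.
  have [Xw wy] : near_center y (xget y (near_center y)).
    by apply: (@xgetPex _ y (near_center y)); exists z.
  exact: overlap.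
exists (\bigcup_(z in X) ball z ((G z).1 / 2)), F; split.
- by apply: bigcup_open => z Xz; apply: ball_open; rewrite divr_gt0 ?r0.
- by move=> z Xz; exists z => //; apply: ballxx; rewrite divr_gt0 ?r0.
- move=> y [z Xz zy]; have [_ [M hM] _] := HG z Xz.
  have /(near_analytic (g := (G z).2)) : \forall x \near y, (G z).2 x = F x.
    have : \forall x \near y, ball z ((G z).1 / 2) x.
      by apply: open_nbhs_nbhs; split=> //; apply: ball_open; rewrite divr_gt0 ?r0.
    by apply: filterS => x zx; rewrite (FE z).
  apply.
  have [|rho rho0 h] := wiener_shift (b := y - z) hM.
    move=> i; have /ball_coordP := zy; rewrite divr_gt0 ?r0// => /(_ isT i)/lt_le_trans; apply.
    by rewrite ler_pdivrMr// ler_pMr ?r0// ler1n.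
  apply: (wiener_analytic rho0); apply: eq_wiener h => u _.
  by rewrite addrA (addrC z) subrK.
- move=> x; have Xx : X (val x) by exact: set_mem (valP x).
  have xx : ball (val x) ((G (val x)).1 / 2) (val x).
    by apply: ballxx; rewrite divr_gt0 ?r0.
  rewrite (FE _ _ Xx xx) -extend_by0_val.
  have [_ _ <-//] := HG _ Xx.
  by apply: ballxx; rewrite r0.
Qed.

Lemma restriction_plot_analytic (X : set 'rV[R]_n) m d :
  analytic_restriction X `<=` plot_analytic m d X.
Proof.
move=> f [U [F [oU XU UF Ff]]] p [_ Xp].
exists (fun u => F (poly_map_eval p u)); last first.
  by apply/near_boxP; exists 1 => // u _ x xE; rewrite -Ff xE.
by apply: analytic_comp_poly; apply: UF; apply: XU; exact: nbhs_singleton Xp.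
Qed.

End Extension.

Theorem theorem1p3 (R : realType) (n : nat) (X : set 'rV[R]_n)
    (hn : (2 <= n)%N) (X_neq0 : X !=set0) (X_closed : closed X)
    (X_simple : simple_set X)
    (X_simplex : forall z, boundary X z ->
       exists S : set 'rV[R]_n, [/\ simplex S, S z & S `<=` X]) :
  plot_analytic 2 2 X = analytic_restriction X.
Proof.
have bnd z : X z -> ~ X° z -> boundary X z by split=> //; exact: subset_closure.
have X_corner z : X z -> exists A, corner X z A.
  move=> Xz; have [/interior_corner//|nXz] := pselect (X° z).
  have [S [sS Sz SX]] := X_simplex z (bnd z Xz nXz).
  have [A [uA SA]] := simplex_corner sS Sz.
  by exists A; split=> // x x01; apply: SX; exact: SA.
apply/seteqP; split; last exact: restriction_plot_analytic.
move=> f f_plot; apply: glue_germs => // z Xz.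
have [Xz'|nXz] := pselect (X° z); first exact: interior_germ.
by apply: boundary_germ => //; exact: bnd.
Qed.
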